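(* Let $G$ be a symmetry group of the discrete Lagrange--Poincaré system $\mathcal M=(E,L_d,\mathcal P)$ over a fiber bundle $\phi:E\to M$, and let $\mathcal A_d^1,\mathcal A_d^2$ be two discrete connections on the principal $G$-bundle $\pi^{M,G}:M\to M/G$. Then the reduced systems $\mathcal M/(G,\mathcal A_d^1)$ and $\mathcal M/(G,\mathcal A_d^2)$ are isomorphic in the category $\mathfrak{LP}_d$.
   Context: Notation. $p_j$ is the projection of a Cartesian product on its $j$-th factor; $D_j$ is the restriction of the differential to the $j$-th factor of a product. A fiber bundle $(E,M,\phi,F)$ is a smooth map $\phi:E\to M$ of manifolds such that every $m\in M$ has an open neighborhood $U$ and a diffeomorphism $\Phi_U:\phi^{-1}(U)\to U\times F$ with $p_1\circ\Phi_U=\phi$ (a trivializing chart). For a left action $l^X$ of a Lie group $G$ on $X$, $\pi^{X,G}:X\to X/G$ is the quotient map. A principal $G$-bundle is a surjective submersion whose total space carries a smooth free left $G$-action with orbits equal to the fibers. Group action on a fiber bundle. $G$ acts on $(E,M,\phi,F)$ if there are smooth free left actions $l^E,l^M$ and a smooth right action $r^F$ on $F$ such that (1) $\pi^{M,G}:M\to M/G$ is a principal $G$-bundle; (2) $\phi$ is $G$-equivariant; (3) every $m\in M$ lies in a $G$-invariant open $U$ with a trivializing chart $\Phi_U$ that is $G$-equivariant for $l^{U\times F}_g(m,f)=(l^M_g(m),r^F_{g^{-1}}(f))$ on $U\times F$. DLPS. For a fiber bundle $\phi:E\to M$ put $C'(E)=E\times M$ and $C''(E)=\{((\epsilon_0,m_1),(\epsilon_1,m_2))\in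 C'(E)^2: m_1=\phi(\epsilon_1)\}$. A discrete Lagrange--Poincaré system (DLPS) over $E$ is $\mathcal M=(E,L_d,\mathcal P)$ with $L_d:C'(E)\to\mathbb R$ smooth and $\mathcal P$ an infinitesimal variation chaining map: a smooth family of linear maps $\mathcal P((\epsilon_0,m_1),(\epsilon_1,m_2)):T_{\epsilon_1}E\to\ker d\phi(\epsilon_0)\subset T_{\epsilon_0}E$ indexed by $C''(E)$ (a vector bundle homomorphism). Category $\mathfrak{LP}_d$. Objects are DLPSs. A morphism from $(E,L_d,\mathcal P)$ (over $\phi:E\to M$) to $(E',L_d',\mathcal P')$ (over $\phi':E'\to M'$) is a map $\Upsilon:C'(E)\to C'(E')$ such that: (1) $\Upsilon$ is a surjective submersion; (2) $D_1(p_1\circ\Upsilon)(\epsilon_0,m_1):T_{\epsilon_0}E\to T_{p_1(\Upsilon(\epsilon_0,m_1))}E'$ is onto for all $(\epsilon_0,m_1)$; (3) $D_1(p_2\circ\Upsilon)=0$; (4) for all $((\epsilon_0,m_1),(\epsilon_1,m_2))\in C''(E)$, $p_2(\Upsilon(\epsilon_0,m_1))=\phi'(p_1(\Upsilon(\epsilon_1,m_2)))$, so that $\Upsilon\times\Upsilon$ restricts to $\Upsilon^{(2)}:C''(E)\to C''(E')$; (5) $L_d=L_d'\circ\Upsilon$; (6) for all $\eta=((\epsilon_0,m_1),(\epsilon_1,m_2))\in C''(E)$, $\delta\epsilon_1\in T_{\epsilon_1}E$: $\mathcal P'(\Upsilon^{(2)}(\eta))(D_1(p_1\circ\Upsilon)(\epsilon_1,m_2)(\delta\epsilon_1))=d(p_1\circ\Upsilon)(\epsilon_0,m_1)(\mathcal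 P(\eta)(\delta\epsilon_1),d\phi(\epsilon_1)(\delta\epsilon_1))$. Composition and identities are those of maps. Symmetry group. $G$ is a symmetry group of $\mathcal M=(E,L_d,\mathcal P)$ if $G$ acts on the fiber bundle $E$, $L_d$ is invariant under $l^{C'(E)}_g(\epsilon_0,m_1)=(l^E_g(\epsilon_0),l^M_g(m_1))$, and $\mathcal P$ is equivariant: $\mathcal P(l^{C'(E)}_g(\epsilon_0,m_1),l^{C'(E)}_g(\epsilon_1,m_2))(dl^E_g(\delta\epsilon_1))=dl^E_g(\mathcal P((\epsilon_0,m_1),(\epsilon_1,m_2))(\delta\epsilon_1))$ for all $g\in G$. Discrete connections. A discrete connection $\mathcal A_d$ on a principal $G$-bundle $\pi^{M,G}:M\to M/G$ is given by a submanifold $Hor\subset M\times M$, invariant under the diagonal $G$-action and containing the diagonal, such that $(id_M\times\pi^{M,G})|_{Hor}:Hor\to M\times(M/G)$ is an injective local diffeomorphism. Convention: it is treated as globally defined (this map is onto), so that for all $m_0,m_1$ there is a unique $g=:\mathcal A_d(m_0,m_1)\in G$ with $(m_0,l^M_{g^{-1}}(m_1))\in Hor$; the function $\mathcal A_d:M\times M\to G$ is smooth. Reduction. $\tilde G_E:=(E\times G)/G$ is the quotient by $g\cdot(\epsilon,w)=(l^E_g(\epsilon),gwg^{-1})$; it is a fiber bundle over $M/G$ with projection $p^{M/G}(\pi^{E\times G,G}(\epsilon,w))=\pi^{M,G}(\phi(\epsilon))$ and fiber $F\times G$, so $C'(\tilde G_E)=\tilde G_E\times(M/G)$. Given $\mathcal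 A_d$ on $\pi^{M,G}$, let $\Upsilon_{\mathcal A_d}:C'(E)\to C'(\tilde G_E)$, $\Upsilon_{\mathcal A_d}(\epsilon,m)=(\pi^{E\times G,G}(\epsilon,\mathcal A_d(\phi(\epsilon),m)),\pi^{M,G}(m))$. If $G$ is a symmetry group of $\mathcal M$, the reduced DLPS $\mathcal M/(G,\mathcal A_d)=(\tilde G_E,\check L_d,\check{\mathcal P})$ is defined by $\check L_d\circ\Upsilon_{\mathcal A_d}=L_d$ and $\check{\mathcal P}((v_0,r_1),(v_1,r_2))(\delta v_1)=D_1(p_1\circ\Upsilon_{\mathcal A_d})(\epsilon_0,m_1)(\mathcal P((\epsilon_0,m_1),(\epsilon_1,m_2))(\delta\epsilon_1))+D_2(p_1\circ\Upsilon_{\mathcal A_d})(\epsilon_0,m_1)(d\phi(\epsilon_1)(\delta\epsilon_1))$, where $((\epsilon_0,m_1),(\epsilon_1,m_2))\in C''(E)$ is any element with $\Upsilon_{\mathcal A_d}(\epsilon_0,m_1)=(v_0,r_1)$, $\Upsilon_{\mathcal A_d}(\epsilon_1,m_2)=(v_1,r_2)$ and $\delta\epsilon_1$ is the unique vector with $D_1(p_1\circ\Upsilon_{\mathcal A_d})(\epsilon_1,m_2)(\delta\epsilon_1)=\delta v_1$ (this is well defined). *)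

(* Defs.v *)
From HB Require Import structures.
From mathcomp Require Import all_boot all_order all_algebra.
From mathcomp Require Import boolp classical_sets functions cardinality reals.
From mathcomp Require Import topology normedtype landau derive.

Set Implicit Arguments.
Unset Strict Implicit.
Unset Printing Implicit Defensive.

Import Order.TTheory GRing.Theory Num.Theory.
Import numFieldNormedType.Exports.
Local Open Scope classical_set_scope.
Local Open Scope ring_scope.

Section SmoothCalculus.
Context {R : realType}.

(* In finite dimension, f is C^(k+1) on the open set A iff it is Fréchet
   differentiable on A and every directional derivative is C^k on A. *)
Fixpoint Ck (V W : normedModType R) (k : nat) (A : set V) (f : V -> W) : Prop :=
  match k with
  | 0%N => forall x, A x -> {for x, continuous f}
  | k'.+1 => (forall x, A x -> differentiable f x) /\
             (forall v : V, Ck k' A (fun x => 'd f x v))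
  end.

Definition Csmooth (V W : normedModType R) (A : set V) (f : V -> W) : Prop :=
  forall k, Ck k A f.

Lemma near_eq_diff (V W : normedModType R) (f g : V -> W) x :
  (\forall y \near x, f y = g y) -> differentiable f x ->
  differentiable g x /\ 'd g x = 'd f x :> (V -> W).
Proof.
move=> fg df.
have fgx : f x = g x by exact: (nbhs_singleton fg).
have [cdf fE] := (diff_locallyP x f).1 df.
have fg0 : \forall h \near (0 : V), f (h + x) = g (h + x).
  move: fg; rewrite (near_shift 0) subr0; apply: filterS => h /=.
  by [].
have gE : g \o shift x = cst (g x) + 'd f x +o_ (0 : V) id.
  apply/eqaddoP => e e0.
  have /(_ e e0) fo := (eqaddoP _ _ _ _).1 fE.
  near=> h.
  have <- : (f \o shift x - (cst (f x) + 'd f x)) h =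
            (g \o shift x - (cst (g x) + 'd f x)) h.
    rewrite !fctE /= fgx; congr (_ - _).
    by near: h.
  by near: h.
have dg := diff_unique cdf gE.
split; last exact: dg.
by apply/diff_locallyP; rewrite dg; split.
Unshelve. all: by end_near. Qed.

Lemma Ck_ext (V W : normedModType R) k (A : set V) (f g : V -> W) :
  open A -> (forall x, A x -> f x = g x) -> Ck k A f -> Ck k A g.
Proof.
move=> oA; elim: k f g => [|k IH] f g fg.
  move=> fA x Ax; rewrite /prop_for /continuous_at -(fg x Ax).
  apply: cvg_trans (fA x Ax); apply: near_eq_cvg.
  by apply: filterS (open_nbhs_nbhs (conj oA Ax)) => y /fg.
have nfg x : A x -> \forall y \near x, f y = g y.
  by move=> Ax; apply: filterS (open_nbhs_nbhs (conj oA Ax)) => y /fg.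
move=> [df fA]; split=> [x Ax|v].
  exact: (near_eq_diff (nfg x Ax) (df x Ax)).1.
apply: IH (fA v) => x Ax.
exact: esym (congr1 (@^~ v) (near_eq_diff (nfg x Ax) (df x Ax)).2).
Qed.

Lemma mx_cvg (T : topologicalType) m n (f : T -> 'M[R]_(m, n)) x :
  (forall i j, {for x, continuous (fun y => f y i j)}) ->
  {for x, continuous f}.
Proof.
move=> fc A [P PA sA].
apply: filterS (_ : \forall y \near x, forall i j, P i j (f y i j)).
  by move=> y Py; apply: sA.
apply: filter_forall => i; apply: filter_forall => j.
exact: (fc i j _ (PA i j)).
Qed.

Lemma row_mx_cvg (T : topologicalType) n1 n2 (f : T -> 'rV[R]_n1)
    (g : T -> 'rV[R]_n2) x :
  {for x, continuous f} -> {for x, continuous g} ->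
  {for x, continuous (fun y => row_mx (f y) (g y))}.
Proof.
move=> fc gc; apply: mx_cvg => i j.
case: (split_ordP j) => k ->.
  rewrite (_ : (fun y => _) = fun y => f y i k); last first.
    by apply/funext => y; rewrite row_mxEl.
  exact: (@continuous_comp _ _ _ f (fun M : 'rV[R]__ => M i k) x fc
            (@coord_continuous R _ _ i k _)).
rewrite (_ : (fun y => _) = fun y => g y i k); last first.
  by apply/funext => y; rewrite row_mxEr.
exact: (@continuous_comp _ _ _ g (fun M : 'rV[R]__ => M i k) x gc
          (@coord_continuous R _ _ i k _)).
Qed.

Definition row_inl n1 n2 (u : 'rV[R]_n1) : 'rV[R]_(n1 + n2) := row_mx u 0.
Definition row_inr n1 n2 (u : 'rV[R]_n2) : 'rV[R]_(n1 + n2) := row_mx 0 u.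

Fact row_inl_linear n1 n2 : linear (@row_inl n1 n2).
Proof.
by move=> a u v; rewrite /row_inl scale_row_mx add_row_mx scaler0 addr0.
Qed.
Fact row_inr_linear n1 n2 : linear (@row_inr n1 n2).
Proof.
by move=> a u v; rewrite /row_inr scale_row_mx add_row_mx scaler0 addr0.
Qed.
HB.instance Definition _ n1 n2 :=
  GRing.isLinear.Build R _ _ _ (@row_inl n1 n2) (@row_inl_linear n1 n2).
HB.instance Definition _ n1 n2 :=
  GRing.isLinear.Build R _ _ _ (@row_inr n1 n2) (@row_inr_linear n1 n2).

Lemma row_inl_continuous n1 n2 : continuous (@row_inl n1 n2).
Proof.
move=> x.
have h1 : {for x, continuous (fun y : 'rV[R]_n1 => y)} by move=> A.
have h2 : {for x, continuous (fun y : 'rV[R]_n1 => 0 : 'rV[R]_n2)}.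
  exact: cst_continuous.
by refine (row_mx_cvg h1 h2).
Qed.
Lemma row_inr_continuous n1 n2 : continuous (@row_inr n1 n2).
Proof.
move=> x.
have h1 : {for x, continuous (fun y : 'rV[R]_n2 => y)} by move=> A.
have h2 : {for x, continuous (fun y : 'rV[R]_n2 => 0 : 'rV[R]_n1)}.
  exact: cst_continuous.
by refine (row_mx_cvg h2 h1).
Qed.

Lemma row_inl_differentiable n1 n2 (u : 'rV[R]_n1) :
  differentiable (@row_inl n1 n2) u.
Proof.
exact: (@linear_differentiable R _ _ (@row_inl n1 n2) u
          (@row_inl_continuous n1 n2)).
Qed.
Lemma diff_row_inl n1 n2 (u : 'rV[R]_n1) :
  'd (@row_inl n1 n2) u = @row_inl n1 n2 :> ('rV[R]_n1 -> 'rV[R]_(n1 + n2)).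
Proof.
exact: (@diff_lin R _ _ (@row_inl n1 n2) u (@row_inl_continuous n1 n2)).
Qed.
Lemma row_inr_differentiable n1 n2 (u : 'rV[R]_n2) :
  differentiable (@row_inr n1 n2) u.
Proof.
exact: (@linear_differentiable R _ _ (@row_inr n1 n2) u
          (@row_inr_continuous n1 n2)).
Qed.
Lemma diff_row_inr n1 n2 (u : 'rV[R]_n2) :
  'd (@row_inr n1 n2) u = @row_inr n1 n2 :> ('rV[R]_n2 -> 'rV[R]_(n1 + n2)).
Proof.
exact: (@diff_lin R _ _ (@row_inr n1 n2) u (@row_inr_continuous n1 n2)).
Qed.

Definition row_prod n1 n2 m1 m2 (f : 'rV[R]_n1 -> 'rV[R]_m1)
    (g : 'rV[R]_n2 -> 'rV[R]_m2) (x : 'rV[R]_(n1 + n2)) : 'rV[R]_(m1 + m2) :=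
  row_mx (f (lsubmx x)) (g (rsubmx x)).

Lemma row_prod_diff n1 n2 m1 m2 (f : 'rV[R]_n1 -> 'rV[R]_m1)
    (g : 'rV[R]_n2 -> 'rV[R]_m2) (x : 'rV[R]_(n1 + n2)) :
  differentiable f (lsubmx x) -> differentiable g (rsubmx x) ->
  differentiable (row_prod f g) x /\
  'd (row_prod f g) x = row_prod ('d f (lsubmx x)) ('d g (rsubmx x))
    :> ('rV[R]_(n1 + n2) -> 'rV[R]_(m1 + m2)).
Proof.
move=> df dg.
have E (f' : 'rV[R]_n1 -> 'rV[R]_m1) (g' : 'rV[R]_n2 -> 'rV[R]_m2) :
    row_prod f' g' = (@row_inl m1 m2 \o (f' \o lsubmx))
                     + (@row_inr m1 m2 \o (g' \o rsubmx)).
  apply/funext => y; rewrite fctE /= /row_inl /row_inr /row_prod.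
  by rewrite add_row_mx addr0 add0r.
have dl := @differentiable_lsubmx R 1 n1 n2 x.
have dr := @differentiable_rsubmx R 1 n1 n2 x.
have dfl := differentiable_comp dl df.
have dgr := differentiable_comp dr dg.
have dil := row_inl_differentiable m2 (f (lsubmx x)).
have dir := row_inr_differentiable m1 (g (rsubmx x)).
have d1 : differentiable (@row_inl m1 m2 \o (f \o lsubmx)) x.
  exact: differentiable_comp dfl dil.
have d2 : differentiable (@row_inr m1 m2 \o (g \o rsubmx)) x.
  exact: differentiable_comp dgr dir.
have e1 : 'd (@row_inl m1 m2 \o (f \o lsubmx)) x
    = @row_inl m1 m2 \o ('d f (lsubmx x) \o lsubmx)
    :> ('rV[R]_(n1 + n2) -> 'rV[R]_(m1 + m2)).
  rewrite (diff_comp dfl dil) (diff_comp dl df) diff_row_inl.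
  by rewrite (diff_lin _ (@continuous_lsubmx R 1 n1 n2)).
have e2 : 'd (@row_inr m1 m2 \o (g \o rsubmx)) x
    = @row_inr m1 m2 \o ('d g (rsubmx x) \o rsubmx)
    :> ('rV[R]_(n1 + n2) -> 'rV[R]_(m1 + m2)).
  rewrite (diff_comp dgr dir) (diff_comp dr dg) diff_row_inr.
  by rewrite (diff_lin _ (@continuous_rsubmx R 1 n1 n2)).
rewrite [row_prod f g]E; split; first exact: differentiableD d1 d2.
apply/funext => v.
pose ev (F : 'rV[R]_(n1 + n2) -> 'rV[R]_(m1 + m2)) := F v.
have eD : ev ('d _ x) = _ := congr1 ev (diffD d1 d2).
refine (eq_trans eD _).
refine (eq_trans (f_equal2 +%R (congr1 ev e1) (congr1 ev e2)) _).
by rewrite /ev /= /row_inl /row_inr add_row_mx addr0 add0r.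
Qed.

Lemma row_prod_Ck n1 n2 m1 m2 k (A : set 'rV[R]_n1) (B : set 'rV[R]_n2)
    (f : 'rV[R]_n1 -> 'rV[R]_m1) (g : 'rV[R]_n2 -> 'rV[R]_m2) :
  open A -> open B -> Ck k A f -> Ck k B g ->
  Ck k (lsubmx @^-1` A `&` rsubmx @^-1` B) (row_prod f g).
Proof.
move=> oA oB; elim: k f g => [|k IH] f g.
  move=> fA gB x [Ax Bx]; apply: row_mx_cvg.
    by apply: continuous_comp (fA _ Ax); apply: continuous_lsubmx.
  by apply: continuous_comp (gB _ Bx); apply: continuous_rsubmx.
move=> [df fA] [dg gB]; split=> [x [Ax Bx]|v].
  exact: (row_prod_diff (df _ Ax) (dg _ Bx)).1.
apply: Ck_ext (IH _ _ (fA (lsubmx v)) (gB (rsubmx v))).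
  apply: openI; apply: open_comp => // x _;
    [exact: continuous_lsubmx|exact: continuous_rsubmx].
by move=> x [Ax Bx]; rewrite (row_prod_diff (df _ Ax) (dg _ Bx)).2.
Qed.

End SmoothCalculus.
Section Manifolds.
Context {R : realType}.

Record chart (T : topologicalType) (n : nat) := Chart {
  cdom : set T;
  cmap :> T -> 'rV[R]_n;
  cinv : 'rV[R]_n -> T;
  cdom_open : open cdom;
  cimg_open : open (cmap @` cdom);
  cmapK : forall p, cdom p -> cinv (cmap p) = p;
  cmap_cont : forall p, cdom p -> {for p, continuous cmap};
  cinv_cont : forall x, (cmap @` cdom) x -> {for x, continuous cinv} }.

Definition cimg (T : topologicalType) n (a : chart T n) : set 'rV[R]_n :=
  a @` cdom a.

Definition chart_compat (T : topologicalType) n (a b : chart T n) : Prop :=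
  Csmooth [set x | cimg a x /\ cdom b (cinv a x)] (b \o cinv a).

(* chart_at singles out, at each point, one chart of the atlas; it serves only
   to represent tangent vectors by their coordinates (see tangent below). *)
Record manifold := Manifold {
  mcar :> topologicalType;
  mdim : nat;
  mhausdorff : hausdorff_space mcar;
  mcountable : @second_countable mcar;
  atlas : set (chart mcar mdim);
  chart_at : mcar -> chart mcar mdim;
  chart_at_atlas : forall p, atlas (chart_at p);
  chart_at_dom : forall p, cdom (chart_at p) p;
  atlas_compat : forall a b, atlas a -> atlas b -> chart_compat a b }.

Definition smooth_on (M N : manifold) (A : set M) (f : M -> N) : Prop :=
  (forall p, A p -> {for p, continuous f}) /\
  (forall a b, atlas a -> atlas b ->
     Csmooth [set x | [/\ cimg a x, A (cinv a x) & cdom b (f (cinv a x))]]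
             (b \o f \o cinv a)).

Definition smooth (M N : manifold) (f : M -> N) : Prop := smooth_on setT f.

Definition vsmooth_on (M : manifold) (V : normedModType R) (A : set M)
    (f : M -> V) : Prop :=
  forall a, atlas a ->
    Csmooth [set x | cimg a x /\ A (cinv a x)] (f \o cinv a).

(* A tangent vector at p is given by its components in the chart chart_at p;
   its components in an arbitrary chart a around p are tcoord a v. *)
Definition tangent (M : manifold) (p : M) : normedModType R := 'rV[R]_(mdim M).

Definition tcoord (M : manifold) (a : chart M (mdim M)) (p : M)
    (v : tangent p) : 'rV[R]_(mdim M) :=
  'd (a \o cinv (chart_at p)) (chart_at p p) v.

Definition tvec (M : manifold) (a : chart M (mdim M)) (p : M)
    (u : 'rV[R]_(mdim M)) : tangent p :=
  'd (chart_at p \o cinv a) (a p) u.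

Definition mdiff (M N : manifold) (f : M -> N) (p : M) (v : tangent p) :
    tangent (f p) :=
  'd (chart_at (f p) \o f \o cinv (chart_at p)) (chart_at p p) v.

Definition submersion (M N : manifold) (f : M -> N) : Prop :=
  smooth f /\ forall (p : M) (w : tangent (f p)), exists v, mdiff f v = w.

End Manifolds.

Section Product.
Context {R : realType}.

Section ProdChart.
Variables (T U : topologicalType) (n m : nat) (a : chart (R := R) T n)
  (b : chart (R := R) U m).

Definition prod_cdom : set (T * U) := [set p | cdom a p.1 /\ cdom b p.2].
Definition prod_cmap (p : T * U) : 'rV[R]_(n + m) := row_mx (a p.1) (b p.2).
Definition prod_cinv (x : 'rV[R]_(n + m)) : T * U :=
  (cinv a (lsubmx x), cinv b (rsubmx x)).

Fact prod_cimgE : prod_cmap @` prod_cdom =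
  lsubmx @^-1` cimg a `&` rsubmx @^-1` cimg b.
Proof.
apply/seteqP; split=> [_ [p [ap bp] <-]|x [[p ap pE] [q bq qE]]].
  by split; rewrite /prod_cmap /= ?row_mxKl ?row_mxKr; [exists p.1|exists p.2].
by exists (p, q) => //; rewrite /prod_cmap /= pE qE hsubmxK.
Qed.

Fact prod_cdom_open : open prod_cdom.
Proof.
rewrite openE => p [ap bp]; exists (cdom a, cdom b) => /=; last by [].
by split; apply: open_nbhs_nbhs; split=> //; apply: cdom_open.
Qed.

Fact prod_cimg_open : open (prod_cmap @` prod_cdom).
Proof.
rewrite prod_cimgE; apply: openI.
  apply: (@open_comp _ _ lsubmx); last exact: cimg_open.
  by move=> x _; apply: continuous_lsubmx.
apply: (@open_comp _ _ rsubmx); last exact: cimg_open.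
by move=> x _; apply: continuous_rsubmx.
Qed.

Fact prod_cmapK p : prod_cdom p -> prod_cinv (prod_cmap p) = p.
Proof.
case: p => p q [/= ap bq].
by rewrite /prod_cinv /prod_cmap /= row_mxKl row_mxKr !cmapK.
Qed.

Fact prod_cmap_cont p : prod_cdom p -> {for p, continuous prod_cmap}.
Proof.
move=> [ap bp].
have h1 : {for p, continuous (fun p : T * U => a p.1)}.
  exact: (@continuous_comp _ _ _ fst a p (@cvg_fst _ _ _ _ _) (cmap_cont ap)).
have h2 : {for p, continuous (fun p : T * U => b p.2)}.
  exact: (@continuous_comp _ _ _ snd b p (@cvg_snd _ _ _ _ _) (cmap_cont bp)).
by refine (row_mx_cvg h1 h2).
Qed.

Fact prod_cinv_cont x :
  (prod_cmap @` prod_cdom) x -> {for x, continuous prod_cinv}.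
Proof.
rewrite prod_cimgE => -[ax bx].
have h1 : {for x, continuous (fun x : 'rV[R]_(n + m) => cinv a (lsubmx x))}.
  exact: (@continuous_comp _ _ _ lsubmx (cinv a) x
    (@continuous_lsubmx _ _ _ _ x) (cinv_cont ax)).
have h2 : {for x, continuous (fun x : 'rV[R]_(n + m) => cinv b (rsubmx x))}.
  exact: (@continuous_comp _ _ _ rsubmx (cinv b) x
    (@continuous_rsubmx _ _ _ _ x) (cinv_cont bx)).
exact: (cvg_pair h1 h2).
Qed.

Definition prod_chart : chart (R := R) (T * U)%type (n + m) :=
  Chart prod_cdom_open prod_cimg_open prod_cmapK prod_cmap_cont prod_cinv_cont.

End ProdChart.

Fact transition_open (T : topologicalType) n (a b : chart (R := R) T n) :
  open [set x | cimg a x /\ cdom b (cinv a x)].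
Proof.
rewrite openE => x [ax bx].
apply: (@filterI _ (nbhs x)).
  by apply: open_nbhs_nbhs; split=> //; apply: cimg_open.
apply: (cinv_cont ax); apply: open_nbhs_nbhs.
by split=> //; apply: cdom_open.
Qed.

Fact prod_chart_compat (T U : topologicalType) n m
    (a a' : chart (R := R) T n) (b b' : chart (R := R) U m) :
  chart_compat a a' -> chart_compat b b' ->
  chart_compat (prod_chart a b) (prod_chart a' b').
Proof.
move=> aa bb k.
have := row_prod_Ck (@transition_open _ _ a a') (@transition_open _ _ b b')
  (aa k) (bb k).
rewrite (_ : lsubmx @^-1` _ `&` _ =
  [set x | cimg (prod_chart a b) x /\
           cdom (prod_chart a' b') (cinv (prod_chart a b) x)]) //.
have -> : cimg (prod_chart a b) = _ := prod_cimgE a b.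
apply/seteqP; split=> x /=.
  by move=> [[? ?] [? ?]].
by move=> [[? ?] [? ?]].
Qed.

Fact prod_hausdorff (T U : topologicalType) :
  hausdorff_space T -> hausdorff_space U -> hausdorff_space (T * U)%type.
Proof.
move=> hT hU [p1 p2] [q1 q2] clu; congr (_, _).
  apply: hT => A B pA qB.
  have [] := clu [set x | A x.1] [set x | B x.1].
  - by exists (A, setT) => /= [|x []//]; split=> //; apply: filterT.
  - by exists (B, setT) => /= [|x []//]; split=> //; apply: filterT.
  - by move=> x [? ?]; exists x.1.
apply: hU => A B pA qB.
have [] := clu [set x | A x.2] [set x | B x.2].
- by exists (setT, A) => /= [|x []//]; split=> //; apply: filterT.
- by exists (setT, B) => /= [|x []//]; split=> //; apply: filterT.
- by move=> x [? ?]; exists x.2.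
Qed.

Fact prod_second_countable (T U : topologicalType) :
  @second_countable T -> @second_countable U ->
  @second_countable (T * U)%type.
Proof.
move=> [B cB [oB bB]] [C cC [oC bC]].
exists ((fun P : set T * set U => P.1 `*` P.2) @` (B `*` C)).
  apply: sub_countable; first exact: card_image_le.
  exact: countableX.
split=> [_ [[P Q] [/= BP CQ] <-]|[p q] A [[P Q] /= [pP qQ] PQA]].
  rewrite openE => -[x y] [/= Px Qy]; exists (P, Q) => //=.
  by split; apply: open_nbhs_nbhs; split=> //; [apply: oB|apply: oC].
have [P' [BP' P'p] P'P] := bB p P pP.
have [Q' [CQ' Q'q] Q'Q] := bC q Q qQ.
exists (P' `*` Q'); first by split=> //; exists (P', Q').
by move=> [x y] [/= /P'P Px /Q'Q Qy]; apply: PQA.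
Qed.

Section ProdManifold.
Variables M N : @manifold R.

Definition prod_atlas : set (chart (R := R) (M * N)%type (mdim M + mdim N)) :=
  [set c | exists a b, [/\ atlas a, atlas b & c = prod_chart a b]].

Fact prod_chart_at_atlas p :
  prod_atlas (prod_chart (chart_at p.1) (chart_at p.2)).
Proof.
by exists (chart_at p.1), (chart_at p.2); split=> //; apply: chart_at_atlas.
Qed.

Fact prod_chart_at_dom (p : M * N) :
  cdom (prod_chart (chart_at p.1) (chart_at p.2)) p.
Proof. by split; apply: chart_at_dom. Qed.

Fact prod_atlas_compat c d : prod_atlas c -> prod_atlas d -> chart_compat c d.
Proof.
move=> [a [b [aa ab ->]]] [a' [b' [aa' ab' ->]]].
by apply: prod_chart_compat; apply: atlas_compat.
Qed.

(* The tangent space of prodM M N at (p, q) consists of the row_mx v w with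
   v tangent at p and w tangent at q. *)
Definition prodM : @manifold R :=
  Manifold (prod_hausdorff (@mhausdorff _ M) (@mhausdorff _ N))
    (prod_second_countable (mcountable M) (mcountable N))
    prod_chart_at_atlas prod_chart_at_dom prod_atlas_compat.

End ProdManifold.
End Product.

Arguments mdiff {R M N} f p v.
Arguments smooth_on {R M N} A f.
Arguments smooth {R M N} f.
Arguments submersion {R M N} f.

Section Bundles.
Context {R : realType}.
Local Notation manifold := (@manifold R).

(* Maps between open subsets are represented by total functions, whose values
   outside the subset are irrelevant. *)
Definition diffeo_on (M N : manifold) (A : set M) (B : set N) (f : M -> N) :=
  smooth_on A f /\
  exists g : N -> M,
    [/\ smooth_on B g,
        forall p, A p -> B (f p) /\ g (f p) = p &
        forall q, B q -> A (g q) /\ f (g q) = q].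

Definition trivializing_chart (E M F : manifold) (phi : E -> M) (U : set M)
    (Phi : E -> prodM M F) : Prop :=
  [/\ open U,
      diffeo_on (phi @^-1` U) [set x : prodM M F | U x.1] Phi &
      forall e, U (phi e) -> (Phi e).1 = phi e].

Record fiber_bundle (E M F : manifold) := FiberBundle {
  bproj :> E -> M;
  bproj_smooth : smooth bproj;
  btriv : forall m, exists (U : set M) (Phi : E -> prodM M F),
    U m /\ trivializing_chart bproj U Phi }.

Record lie_group := LieGroup {
  lgcar :> manifold;
  lgmul : lgcar -> lgcar -> lgcar;
  lgone : lgcar;
  lginv : lgcar -> lgcar;
  lgmulA : associative lgmul;
  lgmul1 : left_id lgone lgmul;
  lgmulV : left_inverse lgone lginv lgmul;
  lgmul_smooth : smooth (fun x : prodM lgcar lgcar => lgmul x.1 x.2);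
  lginv_smooth : smooth lginv }.

Record free_left_action (G : lie_group) (X : manifold) := FreeLeftAction {
  lact :> G -> X -> X;
  lact1 : forall x, lact (lgone G) x = x;
  lactM : forall g h x, lact (lgmul g h) x = lact g (lact h x);
  lact_smooth : smooth (fun z : prodM G X => lact z.1 z.2);
  lact_free : forall g x, lact g x = x -> g = lgone G }.

Record right_action (G : lie_group) (X : manifold) := RightAction {
  ract :> G -> X -> X;
  ract1 : forall x, ract (lgone G) x = x;
  ractM : forall g h x, ract (lgmul g h) x = ract h (ract g x);
  ract_smooth : smooth (fun z : prodM G X => ract z.1 z.2) }.

(* Q, together with pi, is the quotient manifold X/G: the smooth structure of
   the orbit space is characterized, up to a unique diffeomorphism, by pi being
   a submersion. *)
Definition orbit_quotient (G : lie_group) (X Q : manifold) (l : G -> X -> X)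
    (pi : X -> Q) : Prop :=
  [/\ submersion pi, forall q, exists x, pi x = q &
      forall x y, pi x = pi y <-> exists g, y = l g x].

Record bundle_action (G : lie_group) (E M F : manifold)
    (phi : fiber_bundle E M F) := BundleAction {
  actE : free_left_action G E;
  actM : free_left_action G M;
  actF : right_action G F;
  orbM : manifold;
  piM : M -> orbM;
  piM_principal : orbit_quotient actM piM;
  act_equivariant : forall g e, phi (actE g e) = actM g (phi e);
  act_triv : forall m, exists (U : set M) (Phi : E -> prodM M F),
    [/\ U m,
        forall g p, U p -> U (actM g p),
        trivializing_chart phi U Phi &
        forall g e, U (phi e) ->
          Phi (actE g e) = (actM g (Phi e).1, actF (lginv g) (Phi e).2)] }.

Definition embedded_submanifold (X : manifold) (S : set X) : Prop :=
  exists2 k, (k <= mdim X)%N &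
    forall p, S p -> exists c : chart X (mdim X),
      [/\ cdom c p,
          forall a, atlas a -> chart_compat a c /\ chart_compat c a &
          forall q, cdom c q ->
            (S q <-> forall i : 'I_(mdim X), (k <= i)%N -> c q ord0 i = 0)].

(* The connection is globally defined: dc_onto, dc_fun.
   dc_locdiff: (id x pi) restricted to Hor is a local diffeomorphism. As Hor is
   embedded, a map into Hor is smooth iff it is smooth as a map into M x M. *)
Record discrete_connection (G : lie_group) (M Q : manifold)
    (l : free_left_action G M) (pi : M -> Q) := DiscreteConnection {
  dc_hor : set (prodM M M);
  dc_hor_submanifold : embedded_submanifold dc_hor;
  dc_hor_invariant : forall g m0 m1,
    dc_hor (m0, m1) -> dc_hor (l g m0, l g m1);
  dc_hor_diag : forall m, dc_hor (m, m);
  dc_inj : forall m0 m1 m1',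
    dc_hor (m0, m1) -> dc_hor (m0, m1') -> pi m1 = pi m1' -> m1 = m1';
  dc_onto : forall m0 q, exists2 m1, dc_hor (m0, m1) & pi m1 = q;
  dc_locdiff : forall x, dc_hor x ->
    exists (W : set (prodM M M)) (V : set (prodM M Q))
           (s : prodM M Q -> prodM M M),
      [/\ open W /\ W x, open V, smooth_on V s,
          forall y, dc_hor y -> W y ->
            V (y.1, pi y.2) /\ s (y.1, pi y.2) = y &
          forall z, V z ->
            [/\ dc_hor (s z), W (s z) & ((s z).1, pi (s z).2) = z]];
  dc_fun :> M -> M -> G;
  dc_funP : forall m0 m1 g, dc_hor (m0, l (lginv g) m1) <-> g = dc_fun m0 m1;
  dc_fun_smooth : smooth (fun x : prodM M M => dc_fun x.1 x.2) }.

End Bundles.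

Section LPd.
Context {R : realType}.
Local Notation manifold := (@manifold R).

Definition pdiff1 (M N P : manifold) (f : prodM M N -> P) (c : prodM M N)
    (v : tangent c.1) : tangent (f c) :=
  mdiff (fun x => f (x, c.2)) c.1 v.

Definition pdiff2 (M N P : manifold) (f : prodM M N -> P) (c : prodM M N)
    (v : tangent c.2) : tangent (f c) :=
  mdiff (fun y => f (c.1, y)) c.2 v.

Arguments pdiff1 {M N P} f c v.
Arguments pdiff2 {M N P} f c v.

Definition inC2 (E M F : manifold) (phi : fiber_bundle E M F)
    (c0 c1 : prodM E M) : Prop := c0.2 = phi c1.1.

(* C''(E) is diffeomorphic to E x (E x M) through
   (e0, c1) |-> ((e0, phi c1.1), c1); chain_smooth says that the matrix of the
   chaining map, in charts of E around e0 and c1.1, is smooth on E x (E x M). *)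
Record dlps (E M F : manifold) (phi : fiber_bundle E M F) := DLPS {
  lagr : prodM E M -> R;
  lagr_smooth : vsmooth_on setT (lagr : prodM E M -> R^o);
  chain : forall c0 c1 : prodM E M, inC2 phi c0 c1 ->
    {linear tangent c1.1 -> tangent c0.1};
  chain_ker : forall c0 c1 (h : inC2 phi c0 c1) (v : tangent c1.1),
    mdiff phi c0.1 (chain h v) = 0;
  chain_smooth : forall (a b : chart E (mdim E)) (u : 'rV[R]_(mdim E)),
    atlas a -> atlas b ->
    vsmooth_on [set x : prodM E (prodM E M) | cdom a x.1 /\ cdom b x.2.1]
      (fun x : prodM E (prodM E M) =>
         tcoord a (p := x.1)
           (chain (erefl : inC2 phi (x.1, phi x.2.1) x.2)
                  (tvec b x.2.1 u))) }.

Record lp_morphism (E M F E' M' F' : manifold)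
    (phi : fiber_bundle E M F) (phi' : fiber_bundle E' M' F')
    (D : dlps phi) (D' : dlps phi') (Y : prodM E M -> prodM E' M') : Prop :=
  LPMorphism {
  lpm_submersion : submersion Y;
  lpm_surj : forall c', exists c, Y c = c';
  lpm_D1_onto : forall c (w : tangent (Y c).1),
    exists v, pdiff1 (fun c => (Y c).1) c v = w;
  lpm_D1_base : forall c (v : tangent c.1), pdiff1 (fun c => (Y c).2) c v = 0;
  lpm_C2 : forall c0 c1, inC2 phi c0 c1 -> inC2 phi' (Y c0) (Y c1);
  lpm_lagr : forall c, lagr D c = lagr D' (Y c);
  lpm_chain : forall c0 c1 (h : inC2 phi c0 c1) (v : tangent c1.1),
    chain D' (lpm_C2 h) (pdiff1 (fun c => (Y c).1) c1 v) =
    mdiff (fun c => (Y c).1) c0 (row_mx (chain D h v) (mdiff phi c1.1 v)) }.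

Definition lp_isomorphic (E M F E' M' F' : manifold)
    (phi : fiber_bundle E M F) (phi' : fiber_bundle E' M' F')
    (D : dlps phi) (D' : dlps phi') : Prop :=
  exists (Y : prodM E M -> prodM E' M') (Z : prodM E' M' -> prodM E M),
    [/\ lp_morphism D D' Y, lp_morphism D' D Z, cancel Y Z & cancel Z Y].

Section Reduction.
Variables (G : lie_group (R := R)) (E M F : manifold)
  (phi : fiber_bundle E M F) (a : bundle_action G phi).

Definition actC (g : G) (c : prodM E M) : prodM E M :=
  (actE a g c.1, actM a g c.2).

Record symmetry_group (D : dlps phi) : Prop := SymmetryGroup {
  sym_lagr : forall g c, lagr D (actC g c) = lagr D c;
  sym_chain : forall g c0 c1 (h : inC2 phi c0 c1)
      (h' : inC2 phi (actC g c0) (actC g c1)) (v : tangent c1.1),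
    chain D h' (mdiff (actE a g) c1.1 v) =
    mdiff (actE a g) c0.1 (chain D h v) }.

Definition actEG (g : G) (x : prodM E G) : prodM E G :=
  (actE a g x.1, lgmul (lgmul g x.2) (lginv g)).

(* The bundle (E x G)/G -> M/G with fiber F x G. *)
Record conjugate_bundle := ConjugateBundle {
  cb_total : manifold;
  cb_quot : prodM E G -> cb_total;
  cb_quotP : orbit_quotient actEG cb_quot;
  cb_bundle :> fiber_bundle cb_total (orbM a) (prodM F G);
  cb_proj : forall e w, cb_bundle (cb_quot (e, w)) = piM a (phi e) }.

Variables (GE : conjugate_bundle)
  (A : discrete_connection (actM a) (@piM _ _ _ _ _ _ a)).

Definition red_map (c : prodM E M) : prodM (cb_total GE) (orbM a) :=
  (cb_quot GE (c.1, A (phi c.1) c.2), piM a c.2).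

(* D' is the reduced system D/(G, A). These equations determine the Lagrangian
   and the chaining map of D', since every element of C'(GE), of C''(GE) and
   every tangent vector to the total space of GE is of the displayed form. *)
Record reduced_dlps (D : dlps phi) (D' : dlps GE) : Prop := ReducedDLPS {
  red_lagr : forall c, lagr D' (red_map c) = lagr D c;
  red_chain : forall c0 c1 (h : inC2 phi c0 c1)
      (h' : inC2 GE (red_map c0) (red_map c1)) (v : tangent c1.1),
    chain D' h' (pdiff1 (fun c => (red_map c).1) c1 v) =
    pdiff1 (fun c => (red_map c).1) c0 (chain D h v) +
    pdiff2 (fun c => (red_map c).1) c0 (mdiff phi c1.1 v) }.

End Reduction.
End LPd.

(* Main.v *)
Require Import Defs.
From HB Require Import structures.
From mathcomp Require Import all_boot all_order all_algebra perm.
From mathcomp Require Import boolp classical_sets functions reals.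
From mathcomp Require Import interval_inference.
From mathcomp Require Import topology normedtype sequences landau derive.
From mathcomp Require Import ring lra.

Set Implicit Arguments.
Unset Strict Implicit.
Unset Printing Implicit Defensive.

Import Order.TTheory GRing.Theory Num.Theory.
Import numFieldNormedType.Exports.
Local Open Scope classical_set_scope.
Local Open Scope ring_scope.

(** Both reduction maps have the [G]-orbits of [E * M] as fibres, so
    [Red2 \o Red1^-1] is a well-defined bijection of [C'(GE)], with inverse
    [Red1 \o Red2^-1].  Each reduction map is a surjective submersion: for a
    fixed [m], the map [kappa e = [e, A (phi e, m)]] satisfies
    [kappa (A (phi e, m) w^-1 . e) = [e, w]], so it is onto on tangent spaces
    because the quotient map [E * G -> (E * G) / G] is.  Smoothness descends
    along surjective submersions, which have smooth local sections by the
    inverse function theorem; the remaining conditions on a morphism follow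
    from the chain rule applied to the composite with [Red1]. *)

(** * Calculus of C^k maps *)

Section CkCalculus.
Context {R : realType}.
Implicit Types U V W : normedModType R.

Lemma Ck_subset V W k (A B : set V) (f : V -> W) :
  B `<=` A -> Ck k A f -> Ck k B f.
Proof.
move=> BA; elim: k f => [|k IH] f /=; first by move=> h x /BA /h.
by move=> [df hf]; split=> [x /BA /df //|v]; apply: IH.
Qed.

Lemma Ck_pred V W k (A : set V) (f : V -> W) : Ck k.+1 A f -> Ck k A f.
Proof.
elim: k f => [|k IH] f [df hf].
  by move=> x /df /differentiable_continuous.
by split=> // v; apply: IH.
Qed.

Lemma Ck_diff V W k (A : set V) (f : V -> W) v :
  Ck k.+1 A f -> Ck k A (fun x => 'd f x v).
Proof. by move=> [_]; apply. Qed.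

(** Differentials are taken in the whole space and not relative to [A], so every clause of [Ck] is a
    condition at one point at a time. *)
Lemma Ck_pointwise V W k (A : set V) (f : V -> W) :
  (forall x, A x -> Ck k [set x] f) -> Ck k A f.
Proof.
elim: k f => [|k IH] f h; first by move=> x Ax; apply: (h x Ax).
split=> [x Ax|v]; first by have [+ _] := h x Ax; apply.
by apply: IH => x Ax; have [_] := h x Ax; apply.
Qed.

(** Openness of each [B] lets the agreement of [g] with [f] pass to derivatives ([Ck_ext]); the rest
    is pointwise. *)
Lemma Ck_local V W k (A : set V) (f : V -> W) :
  (forall x, A x -> exists B g,
    [/\ open B, B x, forall y, B y -> g y = f y & Ck k B g]) -> Ck k A f.
Proof.
move=> h; apply: Ck_pointwise => x /h[B [g [oB Bx gf hg]]].
by apply: Ck_subset (Ck_ext oB gf hg) => _ ->.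
Qed.

Lemma Ck_cst V W k (A : set V) (c : W) : Ck k A (cst c).
Proof.
elim: k c => [|k IH] c; first by move=> x _; exact: cst_continuous.
split=> [x _|v]; first exact: differentiable_cst.
rewrite (_ : (fun x => _) = cst 0) //.
by apply/funext => x; rewrite diff_cst.
Qed.

Lemma Ck_linear V W k (A : set V) (f : {linear V -> W}) :
  continuous f -> Ck k A f.
Proof.
move=> fc; case: k => [|k]; first by move=> x _; exact: fc.
split=> [x _|v]; first exact: linear_differentiable.
rewrite (_ : (fun x => _) = cst (f v)); first exact: Ck_cst.
by apply/funext => x; rewrite diff_lin.
Qed.

Lemma CkD V W k (A : set V) (f g : V -> W) :
  open A -> Ck k A f -> Ck k A g -> Ck k A (f + g).
Proof.
move=> oA; elim: k f g => [|k IH] f g.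
  by move=> hf hg x Ax; apply: cvgD; [exact: hf|exact: hg].
move=> [df hf] [dg hg]; split=> [x Ax|v].
  by apply: differentiableD; [exact: df|exact: dg].
apply: Ck_ext (IH _ _ (hf v) (hg v)) => // x Ax.
by rewrite diffD; [|exact: df|exact: dg].
Qed.

Lemma Ck_sum V W k (A : set V) I (r : seq I) (f : I -> V -> W) :
  open A -> (forall i, Ck k A (f i)) -> Ck k A (\sum_(i <- r) f i).
Proof.
move=> oA hf; elim/big_ind: _ => // [|g h]; first exact: Ck_cst.
exact: CkD.
Qed.

Lemma Ck_linear_comp U V W k (A : set U) (f : U -> V) (g : {linear V -> W}) :
  open A -> continuous g -> Ck k A f -> Ck k A (g \o f).
Proof.
move=> oA gc; elim: k f => [|k IH] f.
  by move=> hf x Ax; apply: continuous_comp; [exact: hf|exact: gc].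
have dg x : differentiable g x by exact: linear_differentiable.
move=> [df hf]; split=> [x Ax|v].
  exact: differentiable_comp (df x Ax) (dg _).
apply: Ck_ext (IH _ (hf v)) => // x Ax.
by rewrite diff_comp ?diff_lin //; exact: df.
Qed.

(** Induction by the Leibniz rule; [Ck_pred] lowers the undifferentiated factors to the order of the
    differentiated ones. *)
Lemma CkM V k (A : set V) (f g : V -> R) :
  open A -> Ck k A f -> Ck k A g -> Ck k A (f * g).
Proof.
move=> oA; elim: k f g => [|k IH] f g.
  by move=> hf hg x Ax; apply: cvgM; [exact: hf|exact: hg].
move=> hf' hg'; have [df hf] := hf'; have [dg hg] := hg'.
split=> [x Ax|v].
  by apply: differentiableM; [exact: df|exact: dg].
have h1 := IH _ _ (Ck_pred hf') (hg v).
have h2 := IH _ _ (Ck_pred hg') (hf v).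
apply: Ck_ext (CkD oA h1 h2) => // x Ax.
by rewrite diffM; [|exact: df|exact: dg].
Qed.

Lemma Ck_prod V k (A : set V) I (r : seq I) (f : I -> V -> R) :
  open A -> (forall i, Ck k A (f i)) ->
  Ck k A (fun x => \prod_(i <- r) f i x).
Proof.
move=> oA hf; elim: r => [|i r IH].
  rewrite (_ : (fun x => _) = cst 1); first exact: Ck_cst.
  by apply/funext => x; rewrite big_nil.
rewrite (_ : (fun x => _) = f i * (fun x => \prod_(j <- r) f j x)).
  exact: CkM.
by apply/funext => x; rewrite big_cons.
Qed.

Lemma CkV V k (A : set V) (f : V -> R) :
  open A -> (forall x, A x -> f x != 0) -> Ck k A f ->
  Ck k A (fun x => (f x)^-1).
Proof.
move=> oA f0; elim: k => [|k IH] hf'.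
  by move=> x Ax; apply: cvgV; [exact: f0|exact: hf'].
have [df hf] := hf'; have hV := IH (Ck_pred hf').
split=> [x Ax|v]; first by apply: differentiableV; [exact: df|exact: f0].
have h := CkM oA (CkM oA (CkM oA hV hV) (hf v)) (Ck_cst k A (-1 : R^o)).
apply: Ck_ext h => // x Ax.
rewrite diffV; [|exact: df|exact: f0].
rewrite [LHS]mulrN1 [RHS]mulNr; congr (- (_ * _)).
by rewrite expr2 invfM.
Qed.

Lemma Ck_scalel V W k (A : set V) (f : V -> R) (w : W) :
  open A -> Ck k A f -> Ck k A (fun x => f x *: w).
Proof.
move=> oA; elim: k f => [|k IH] f.
  by move=> hf x Ax; apply: cvgZl; exact: hf.
move=> [df hf]; split=> [x Ax|v]; first by apply: differentiableZl; exact: df.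
apply: Ck_ext (IH _ (hf v)) => // x Ax.
by rewrite diffZl //; exact: df.
Qed.

Lemma rV_sum_delta n (v : 'rV[R]_n) : v = \sum_i v 0 i *: 'e_i.
Proof. exact: row_sum_delta. Qed.

Lemma mx_coord_linear m n (i : 'I_m) (j : 'I_n) :
  linear (fun M : 'M[R]_(m, n) => M i j : R^o).
Proof. by move=> a u v; rewrite !mxE. Qed.

Lemma Ck_mx_coord V m n k (A : set V) (f : V -> 'M[R]_(m, n)) i j :
  open A -> Ck k A f -> Ck k A (fun x => f x i j).
Proof.
move=> oA hf.
pose L := GRing.isLinear.Build _ _ _ _ _ (@mx_coord_linear m n i j).
pose c : {linear 'M[R]_(m, n) -> R^o} :=
  HB.pack (fun M : 'M[R]_(m, n) => M i j : R^o) L.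
by apply: (@Ck_linear_comp _ _ _ _ A f c) => //; exact: coord_continuous.
Qed.

Lemma Ck_rV V n k (A : set V) (f : V -> 'rV[R]_n) :
  open A -> (forall i, Ck k A (fun x => f x 0 i)) -> Ck k A f.
Proof.
move=> oA hf.
rewrite (_ : f = \sum_i (fun x => f x 0 i *: 'e_i)).
  by apply: Ck_sum => // i; apply: Ck_scalel.
by apply/funext => x; rewrite fct_sumE; exact: rV_sum_delta.
Qed.

Lemma diff_rV_sum n V (g : 'rV[R]_n -> V) x v :
  'd g x v = \sum_i v 0 i *: 'd g x 'e_i.
Proof.
by rewrite [v in LHS]rV_sum_delta linear_sum; apply: eq_bigr => i _; rewrite linearZ.
Qed.

(** Chain rule in coordinates: ['d g (f x) ('d f x v)] is the sum of the coordinates of ['d f x v]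
    times the vectors ['d g (f x) 'e_i], and these are composites covered by the induction
    hypothesis. *)
Lemma Ck_comp V n p k (A : set V) (B : set 'rV[R]_n)
    (f : V -> 'rV[R]_n) (g : 'rV[R]_n -> 'rV[R]_p) :
  open A -> (forall x, A x -> B (f x)) -> Ck k A f -> Ck k B g ->
  Ck k A (g \o f).
Proof.
move=> oA AB; elim: k f g AB => [|k IH] f g AB.
  by move=> hf hg x Ax; apply: continuous_comp; [exact: hf|apply: hg; exact: AB].
move=> hf' [dg hg]; have [df _] := hf'.
split=> [x Ax|v].
  by apply: differentiable_comp; [exact: df|apply: dg; exact: AB].
apply: Ck_rV => // j.
have h : Ck k A (\sum_i ((fun x => 'd f x v 0 i) *
    (fun x => 'd g (f x) 'e_i 0 j)) : V -> R).
  apply: Ck_sum => // i; apply: CkM => //.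
    exact: (@Ck_mx_coord V _ _ _ A (fun x => 'd f x v) 0 i oA (Ck_diff v hf')).
  apply: (@Ck_mx_coord _ _ _ _ _ ((fun y => 'd g y 'e_i) \o f)) => //.
  exact: (IH f (fun y => 'd g y 'e_i) AB (Ck_pred hf') (hg _)).
apply: Ck_ext h => // x Ax.
rewrite diff_comp; [|exact: df|by apply: dg; exact: AB].
rewrite fct_sumE [RHS](congr1 (fun w : 'rV_p => w 0 j) (diff_rV_sum g _ _)).
by rewrite summxE; apply: eq_bigr => i _; rewrite mxE.
Qed.

Lemma Ck_det V n k (A : set V) (M : V -> 'M[R]_n) :
  open A -> (forall i j, Ck k A (fun x => M x i j)) ->
  Ck k A (fun x => \det (M x) : R).
Proof.
move=> oA hM.
rewrite (_ : (fun x => _) = \sum_(s : 'S_n)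
    ((fun x => \prod_i M x i (s i)) * cst ((-1) ^+ s))).
  by apply: Ck_sum => // s; apply: CkM => //; [exact: Ck_prod|exact: Ck_cst].
by apply/funext => x; rewrite fct_sumE; apply: eq_bigr => s _; rewrite [RHS]mulrC.
Qed.

(** Cramer's formula: each entry of the inverse is a cofactor divided by the determinant. *)
Lemma Ck_invmx V n k (A : set V) (M : V -> 'M[R]_n) i j :
  open A -> (forall x, A x -> M x \in unitmx) ->
  (forall i j, Ck k A (fun x => M x i j)) ->
  Ck k A (fun x => invmx (M x) i j).
Proof.
move=> oA uM hM.
have h : Ck k A ((fun x => (\det (M x))^-1) *
    (cst ((-1) ^+ (j + i)) * (fun x => \det (row' j (col' i (M x)))))).
  apply: CkM => //.
    apply: CkV => //; last exact: Ck_det.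
    by move=> x /uM; rewrite unitmxE unitfE.
  apply: CkM => //; first exact: Ck_cst.
  apply: Ck_det => // i' j'.
  rewrite (_ : (fun x => _) = (fun x => M x (lift j i') (lift i j'))) //.
  by apply/funext => x; rewrite !mxE.
apply: Ck_ext h => // x Ax.
by rewrite /invmx uM // !mxE.
Qed.

End CkCalculus.

(** * The inverse function theorem *)

(** Makes matrices available as a complete normed space for the fixed-point argument of
    [near_identity_preimage]. *)
HB.instance Definition _ (R : realType) m n := Complete.on 'M[R]_(m, n).

Section InverseFunction.
Context {R : realType}.

Lemma rV_coord_le_norm n (v : 'rV[R]_n) i : `|v 0 i| <= `|v|.
Proof.
rewrite [leRHS]/Num.Def.normr /= mx_normrE.
exact: (le_bigmax _ (fun ij : 'I_1 * 'I_n => `|v ij.1 ij.2|) (0, i)).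
Qed.

Lemma rV_norm_le n (v : 'rV[R]_n) c :
  0 <= c -> (forall i, `|v 0 i| <= c) -> `|v| <= c.
Proof.
move=> c0 vc; rewrite [leLHS]/Num.Def.normr /= mx_normrE.
by apply: bigmax_le => // -[i j] _; rewrite ord1.
Qed.

Lemma rV_linear_continuous n (V : normedModType R)
  (f : {linear 'rV[R]_n -> V}) : continuous f.
Proof.
have -> : (f : _ -> _) = \sum_i (fun x : 'rV[R]_n => x 0 i *: f 'e_i).
  apply/funext => x; rewrite fct_sumE [in LHS](rV_sum_delta x) linear_sum.
  by apply: eq_bigr => i _; rewrite linearZ.
have h : Ck 0 setT (\sum_i (fun x : 'rV[R]_n => x 0 i *: f 'e_i)).
  apply: Ck_sum => [|i]; first exact: openT.
  apply: Ck_scalel => [|x _]; first exact: openT.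
  exact: coord_continuous.
by move=> x; exact: h.
Qed.

(** The norm is the maximum of the absolute values of the coordinates, so the one-variable mean
    value theorem, applied to each coordinate along the segment from [y] to [x], gives the bound
    with the same [e]. *)
Lemma diff_mean_value n m (h : 'rV[R]_n -> 'rV[R]_m) x0 (r e : R) :
  0 <= e ->
  (forall z, ball x0 r z -> differentiable h z) ->
  (forall z, ball x0 r z -> forall v, `|'d h z v| <= e * `|v|) ->
  forall x y, ball x0 r x -> ball x0 r y -> `|h x - h y| <= e * `|x - y|.
Proof.
move=> e0 dh hle x y bx by_.
apply: rV_norm_le => [|i]; first by rewrite mulr_ge0.
pose g (t : R) : 'rV[R]_n := y + t *: (x - y).
pose phi (t : R) : R := h (g t) 0 i.
have bg (t : R) : 0 <= t <= 1 -> ball x0 r (g t).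
  move=> /andP[t0 t1]; move: bx by_; rewrite -ball_normE /= => bx by_.
  (* Balls are convex: a convex combination is bounded by the larger of the two distances to
     [x0]. *)
  have -> : x0 - g t = (1 - t) *: (x0 - y) + t *: (x0 - x).
    rewrite /g !scalerBr !scalerBl !scale1r; apply/rowP => j; rewrite !mxE; ring.
  apply: le_lt_trans (ler_normD _ _) _; rewrite !normrZ.
  rewrite (ger0_norm t0) ger0_norm ?subr_ge0 //.
  have [XY|YX] := lerP `|x0 - x| `|x0 - y|.
    have : 0 <= t * (`|x0 - y| - `|x0 - x|) by rewrite mulr_ge0 ?subr_ge0.
    lra.
  have : 0 <= (1 - t) * (`|x0 - x| - `|x0 - y|).
    by rewrite mulr_ge0 ?subr_ge0 // ltW.
  lra.
have dphi (t : R) : 0 <= t <= 1 -> is_derive t 1 phi ('d h (g t) (x - y) 0 i).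
  move=> /bg /dh dht.
  have dhw := @diff_derivable _ _ _ h (g t) (x - y) dht.
  (* The difference quotient of [phi] at [t] is that of a coordinate of [h] at [g t] in the
     direction [x - y]. *)
  have E : (fun s : R => s^-1 *: ((phi \o shift t) (s *: 1) - phi t)) =
      (fun s : R => s^-1 *: (((fun z => h z 0 i) \o shift (g t))
         (s *: (x - y)) - h (g t) 0 i)).
    apply/funext => s; rewrite /= /phi; congr (_ *: (h _ 0 i - _)).
    by rewrite /g [s *: 1]mulr1 scalerDl addrCA.
  apply: DeriveDef.
    by rewrite /derivable E; exact: (derivable_mxP h (g t) (x - y)).1.
  rewrite /derive E -/(derive _ _ _) -(deriveE (x - y) dht) derive_mx //.
  by rewrite mxE.
have [|||c c01] := @MVT_segment R phi (fun t => 'd h (g t) (x - y) 0 i) 0 1.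
- exact: ler01.
- by move=> t t01; apply: dphi; rewrite !ltW ?(itvP t01).
- apply: derivable_within_continuous => t t01.
  by have := dphi t; rewrite !(itvP t01) => /(_ isT) [].
have g1 : g 1 = x by rewrite /g scale1r addrC subrK.
have g0 : g 0 = y by rewrite /g scale0r addr0.
rewrite subr0 mulr1 /phi g1 g0 => E.
rewrite !mxE E; apply: le_trans (rV_coord_le_norm _ _) _.
by apply: hle; apply: bg; rewrite !(itvP c01).
Qed.

(** By linearity, the estimate for all [v] follows from the continuity at [x0] of the finitely many
    maps sending [z] to ['d f z 'e_j]. *)
Lemma Ck1_near_diff n m (A : set 'rV[R]_n) (f : 'rV[R]_n -> 'rV[R]_m) x0 (e : R) :
  open A -> A x0 -> Ck 1 A f -> 0 < e ->
  exists2 r : R, 0 < r & forall z, ball x0 r z ->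
    A z /\ forall v, `|'d f z v - 'd f x0 v| <= e * `|v|.
Proof.
move=> oA Ax hf e0.
(* Each of the [n] basis directions contributes at most [c * |v|]; dividing by [n.+1] keeps [c]
   positive when [n = 0]. *)
pose c := e / n.+1%:R.
have c0 : 0 < c by rewrite divr_gt0.
have hn : \forall z \near x0, forall j : 'I_n, `|'d f z 'e_j - 'd f x0 'e_j| < c.
  apply: (@filter_forall _ 'I_n
    (fun j z => `|'d f z 'e_j - 'd f x0 'e_j| < c) (nbhs x0)) => j.
  have fj : 'd f z 'e_j @[z --> x0] --> 'd f x0 'e_j := Ck_diff 'e_j hf x0 Ax.
  by have /cvgrPdistC_lt/(_ _ c0) := fj.
have hA : nbhs x0 A by exact: open_nbhs_nbhs.
have [r /= r0 hr] := (nbhs_ballP _ _).1 (filterI hA hn).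
exists r => // z /hr[Az hz]; split=> // v.
have -> : 'd f z v - 'd f x0 v = \sum_j v 0 j *: ('d f z 'e_j - 'd f x0 'e_j).
  rewrite (eq_bigr _ (fun j _ => scalerBr (v 0 j) _ _)) sumrB.
  exact: f_equal2 (diff_rV_sum f z v) (congr1 -%R (diff_rV_sum f x0 v)).
apply: le_trans (ler_norm_sum _ _ _) _.
apply: (@le_trans _ _ (\sum_(j < n) `|v| * c)).
  apply: ler_sum => j _; rewrite normrZ.
  by rewrite ler_pM // ?rV_coord_le_norm // ltW.
rewrite sumr_const card_ord -mulr_natr -mulrA mulrC ler_wpM2r //.
rewrite /c mulrAC ler_pdivrMr // ler_wpM2l ?(ltW e0) //.
by rewrite ler_nat.
Qed.

(** With [k = s (h + z) - s z], differentiability of [g] gives [h = 'd g k + o(k)]; the Lipschitz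
    bound gives [k = O(h)], and inverting ['d g] yields [k = L h + o(h)]. *)
Lemma lipschitz_inverse_diff n (V : set 'rV[R]_n) (g s : 'rV[R]_n -> 'rV[R]_n) z :
  open V -> V z -> (forall y, V y -> g (s y) = y) ->
  (forall y, V y -> `|s y - s z| <= 2 * `|y - z|) ->
  differentiable g (s z) -> lin1_mx ('d g (s z)) \in unitmx ->
  differentiable s z /\
  forall u, 'd s z u = u *m invmx (lin1_mx ('d g (s z))).
Proof.
move=> oV Vz gs sl dg Ju.
set J := lin1_mx _ in Ju *.
pose L : {linear 'rV[R]_n -> 'rV[R]_n} := mulmxr (invmx J).
have Lc : continuous L by exact: rV_linear_continuous.
have [C C0 LC] := linear_lipschitz Lc.
have [_ gE] := (diff_locallyP (s z) g).1 dg.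
suff sE : s \o shift z = cst (s z) + L +o_ (0 : 'rV[R]_n) id.
  have ds := diff_unique Lc sE.
  by split=> [|u]; [apply/diff_locallyP; rewrite ds|rewrite ds].
apply/eqaddoP => e e0.
(* [C] will come from the bound on [L] and 2 from the bound on [s], leaving the error [e * |h|]. *)
pose e' := e / (2 * C).
have e'0 : 0 < e' by rewrite divr_gt0 // mulr_gt0.
have /(_ e' e'0) /nbhs_ballP[d /= d0 hd] := (eqaddoP _ _ _ _).1 gE.
have Vn : \forall h \near (0 : 'rV[R]_n), V (h + z).
  have : \forall y \near z, V y by exact: open_nbhs_nbhs.
  by rewrite (near_shift 0) subr0; apply: filterS => h.
have dn : \forall h \near (0 : 'rV[R]_n), `|h| < d / 2.
  apply/nbhs_ballP; exists (d / 2) => /=; first by rewrite divr_gt0.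
  by move=> h; rewrite -ball_normE /= sub0r normrN.
apply: filterS2 Vn dn => h Vh hlt.
pose k := s (h + z) - s z.
have kh : `|k| <= 2 * `|h| by have := sl _ Vh; rewrite addrK.
have kd : ball 0 d k by rewrite -ball_normE /= sub0r normrN; lra.
have := hd k kd.
rewrite !fctE /= /k subrK (gs _ Vh) (gs _ Vz) -/k => hk.
(* As [L] inverts ['d g (s z)], the remainder of [s] at [h] is minus the image under [L] of the
   remainder of [g] at [k]. *)
have -> : s (h + z) - (s z + h *m invmx J) = - L (h + z - (z + 'd g (s z) k)).
  have -> : h + z - (z + 'd g (s z) k) = h - 'd g (s z) k.
    by rewrite [h + z]addrC opprD addrACA subrr add0r.
  have -> : L (h - 'd g (s z) k) = h *m invmx J - k.
    by rewrite linearB; congr (_ - _); rewrite /= -(mul_rV_lin1 _ k) mulmxK.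
  by rewrite opprB opprD addrA.
rewrite normrN; apply: le_trans (LC _) _.
have h1 : C * `|h + z - (z + 'd g (s z) k)| <= C * (e' * `|k|).
  by rewrite ler_wpM2l // ltW.
have h2 : C * (e' * `|k|) <= C * (e' * (2 * `|h|)).
  by rewrite !ler_wpM2l // ltW.
have h3 : C * (e' * (2 * `|h|)) = e * `|h|.
  by rewrite /e'; field; rewrite gt_eqF.
lra.
Qed.

(** * Local inversion at a point where the differential is the identity *)

Section LocalInverse.
Variables (n : nat) (A : set 'rV[R]_n) (g : 'rV[R]_n -> 'rV[R]_n) (x0 : 'rV[R]_n).
Hypotheses (oA : open A) (Ax0 : A x0) (gA : Csmooth A g)
  (dg0 : forall v, 'd g x0 v = v).

(** The differential of [g - id] vanishes at [x0], so it is at most 1/2 nearby, and the mean value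
    inequality applies. *)
Lemma near_identity : exists2 r : R, 0 < r &
  [/\ forall z, ball x0 r z -> A z,
     forall z, ball x0 r z -> forall v, `|'d g z v - v| <= 2^-1 * `|v| &
     forall x y, ball x0 r x -> ball x0 r y ->
       `|(g x - x) - (g y - y)| <= 2^-1 * `|x - y|].
Proof.
have h0 : (0 : R) < 2^-1 by rewrite invr_gt0.
have [r r0 hr] := Ck1_near_diff oA Ax0 (gA 1) h0.
have hd z : ball x0 r z -> forall v, `|'d g z v - v| <= 2^-1 * `|v|.
  move=> /hr[_ hz] v.
  exact: (eq_ind _ (fun w => `|'d g z v - w| <= 2^-1 * `|v|) (hz v) _ (dg0 v)).
exists r => //; split=> // [z /hr[]//|].
have dg z : ball x0 r z -> differentiable g z.
  by move=> /hr[Az _]; have [+ _] := gA 1; apply.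
have di (z : 'rV[R]_n) : differentiable idfun z by exact: ex_diff.
apply: (@diff_mean_value n n (g - idfun) x0 r 2^-1) => [|z bz|z bz v].
- exact: ltW.
- by apply: differentiableB => //; exact: dg.
have diE : 'd idfun z v = v.
  have := is_diff_id z; case=> _ E; exact: (congr1 (@^~ v) E).
have gE := congr1 (@^~ v) (diffB (dg z bz) (di z)).
rewrite [X in `|X|]gE [X in `|X|](congr1 (fun w => 'd g z v - w) diE).
exact: hd.
Qed.

(** Solutions of [g x = z] are the fixed points of [T x = x - g x + z], a 1/2-contraction of the
    closed ball of radius [r / 2]. *)
Lemma near_identity_preimage (r : R) (z : 'rV[R]_n) :
  0 < r ->
  (forall x y, ball x0 r x -> ball x0 r y ->
       `|(g x - x) - (g y - y)| <= 2^-1 * `|x - y|) ->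
  ball (g x0) (r / 4) z -> exists2 x, ball x0 r x & g x = z.
Proof.
move=> r0 rl zr.
have {}zr : `|g x0 - z| < r / 4 by move: zr; rewrite -ball_normE.
pose U := closed_ball x0 (r / 2).
have r20 : 0 < r / 2 by rewrite divr_gt0.
have UE x : U x = (`|x0 - x| <= r / 2) by rewrite /U closed_ballE.
have Ub x : U x -> ball x0 r x.
  rewrite UE -ball_normE /= => xr; apply: le_lt_trans xr _; lra.
have bx0 : ball x0 r x0 by exact: ballxx.
pose T x := x - g x + z.
(* Half the distance from [x] to [x0] is at most [r / 4], and [z] is within another [r / 4] of
   [g x0]. *)
have TU : set_fun U U T.
  move=> x /[dup] /Ub bx; rewrite !UE /T => xr.
  have -> : x0 - (x - g x + z) = ((g x - x) - (g x0 - x0)) + (g x0 - z).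
    by apply/rowP => j; rewrite !mxE; ring.
  apply: le_trans (ler_normD _ _) _.
  have := rl _ _ bx bx0; rewrite [`|x - x0|]distrC; lra.
have [|||x Ux xE] := @banach_fixed_point R 'rV[R]_n U (mkfun TU).
- exists (2^-1)%:nng; split=> /=; first lra.
  move=> [x y] [/= /Ub bx /Ub by_].
  have -> : T x - T y = - ((g x - x) - (g y - y)).
    by rewrite /T; apply/rowP => j; rewrite !mxE; ring.
  by rewrite normrN; exact: rl.
- exact: closed_ball_closed.
- by exists x0; rewrite UE subrr normr0 ltW.
exists x; first exact: Ub.
have /eqP : x = x - g x + z := xE.
by rewrite -addrA addrC -subr_eq subrr eq_sym addrC subr_eq0 eq_sym => /eqP.
Qed.

(** A choice [s] of preimages is 2-Lipschitz, hence differentiable with ['d s z] inverse to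
    ['d g (s z)]; this formula raises the regularity of [s] by one at each step of an induction. *)
Theorem local_smooth_inverse : exists (V : set 'rV[R]_n) (s : 'rV[R]_n -> 'rV[R]_n),
  [/\ open V, V (g x0), forall z, V z -> A (s z) /\ g (s z) = z & Csmooth V s].
Proof.
have [r r0 [rA rd rl]] := near_identity.
pose V := ball (g x0) (r / 4).
have r4 : 0 < r / 4 by rewrite divr_gt0.
have oV : open V by exact: ball_open.
have [s sP] : {s & forall z, V z -> ball x0 r (s z) /\ g (s z) = z}.
  apply: (@choice _ _ (fun z x => V z -> ball x0 r x /\ g x = z)) => z.
  have [Vz|nVz] := pselect (V z); last by exists 0.
  by have [x bx gx] := near_identity_preimage r0 rl Vz; exists x.
have gs z : V z -> g (s z) = z by move=> /sP[].
have sA z : V z -> A (s z) by move=> /sP[/rA].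
(* The 1/2-Lipschitz bound on [g - id] leaves half of [|s y - s z|] to be absorbed on the left,
   whence the factor 2. *)
have sl z y : V z -> V y -> `|s y - s z| <= 2 * `|y - z|.
  move=> Vz Vy; have [bz gz] := sP _ Vz; have [by_ gy] := sP _ Vy.
  have := rl _ _ by_ bz; rewrite gz gy => h.
  have := ler_normB (y - z) ((y - s y) - (z - s z)).
  have -> : y - z - (y - s y - (z - s z)) = s y - s z.
    by apply/rowP => j; rewrite !mxE; ring.
  lra.
have dg z : V z -> differentiable g (s z).
  by move=> /sA Az; have [+ _] := gA 1; apply.
pose J x := lin1_mx ('d g x).
(* A kernel vector [v] satisfies [|v| <= |v| / 2], hence vanishes. *)
have Ju z : V z -> J (s z) \in unitmx.
  move=> Vz; rewrite -row_free_unit; apply: inj_row_free => v.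
  rewrite mul_rV_lin1 => v0.
  have [bz _] := sP _ Vz.
  have := rd _ bz v; rewrite v0 sub0r normrN => h.
  by apply/normr0_eq0/eqP; rewrite eq_le normr_ge0 andbT; lra.
have ds z : V z -> differentiable s z /\ forall u, 'd s z u = u *m invmx (J (s z)).
  by move=> Vz; apply: (lipschitz_inverse_diff oV) => //
    [y Vy||]; [exact: sl|exact: dg|exact: Ju].
exists V, s; split=> //; first exact: ballxx.
  by move=> z Vz; split; [exact: sA|exact: gs].
elim=> [|k IH].
  by move=> z Vz; have [/differentiable_continuous] := ds _ Vz.
split=> [z /ds[]//|u].
(* The entries of [J (s z)] are partial derivatives of [g] composed with [s], which is [C^k] by
   induction. *)
have h : Ck k V (fun z => u *m invmx (J (s z))).
  apply: Ck_rV => // j.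
  have hj : Ck k V (\sum_i (cst (u 0 i) * (fun z => invmx (J (s z)) i j))).
    apply: Ck_sum => // i; apply: CkM => //; first exact: Ck_cst.
    apply: Ck_invmx => // i' j'.
    have h' : Ck k V (fun z => ((fun x => 'd g x 'e_i') \o s) z 0 j').
      apply: (@Ck_mx_coord _ _ _ _ _ V) => //.
      exact: Ck_comp oV sA IH (Ck_diff _ (gA k.+1)).
    apply: Ck_ext h' => // z Vz.
    by rewrite /J mxE.
  apply: Ck_ext hj => // z Vz.
  by rewrite fct_sumE mxE.
refine (Ck_ext oV _ h) => z Vz.
by have [_ e] := ds _ Vz; exact: (esym (e u)).
Qed.

End LocalInverse.

(** An affine map [a] built from a right inverse of ['d f x0] makes the differential of [f \o a] at
    0 the identity; if [s] is a local inverse of [f \o a], then [a \o s] is a section of [f]. *)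
Theorem local_smooth_section n m (A : set 'rV[R]_n) (f : 'rV[R]_n -> 'rV[R]_m) x0 :
  open A -> A x0 -> Csmooth A f -> (forall w, exists v, 'd f x0 v = w) ->
  exists (V : set 'rV[R]_m) (s : 'rV[R]_m -> 'rV[R]_n),
  [/\ open V, V (f x0), forall z, V z -> A (s z) /\ f (s z) = z & Csmooth V s].
Proof.
move=> oA Ax fA /choice[b bP].
(* The choice [b] of preimages need not be linear: [B] extends its values on the basis linearly. *)
pose B : 'M[R]_(m, n) := \matrix_i b 'e_i.
pose L : {linear 'rV[R]_m -> 'rV[R]_n} := mulmxr B.
have Lc : continuous L by exact: rV_linear_continuous.
pose a : 'rV[R]_m -> 'rV[R]_n := cst x0 + L.
have ac : Csmooth setT a.
  move=> k; apply: CkD; [exact: openT|exact: Ck_cst|exact: Ck_linear].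
have aE y : a y = x0 + y *m B by [].
have a0 : a 0 = x0 by rewrite aE mul0mx addr0.
pose A' := a @^-1` A.
have oA' : open A'.
  by apply: open_comp => // y _; exact: (ac 0).
have A'0 : A' 0 by rewrite /A' /= a0.
have ga : Csmooth A' (f \o a).
  move=> k; apply: (@Ck_comp _ _ _ _ k A' A) => //.
  exact: Ck_subset (ac k).
have dL : differentiable L (0 : 'rV[R]_m) by exact: linear_differentiable.
have dg0 v : 'd (f \o a) 0 v = v.
  have dc := differentiable_cst x0 (0 : 'rV[R]_m).
  have da : differentiable a 0 by exact: differentiableD.
  have df : differentiable f (a 0) by rewrite a0; have [+ _] := fA 1; apply.
  have dav : 'd a 0 v = v *m B.
    refine (eq_trans (congr1 (@^~ v) (diffD dc dL)) _).
    refine (eq_trans (f_equal2 +%R (congr1 (@^~ v) (diff_cst x0 0))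
      (congr1 (@^~ v) (diff_lin 0 Lc))) _).
    exact: add0r.
  refine (eq_trans (congr1 (@^~ v) (diff_comp da df)) _).
  refine (eq_trans (congr1 ('d f (a 0)) dav) _); rewrite a0.
  have -> : v *m B = \sum_i v 0 i *: b 'e_i.
    by rewrite mulmx_sum_row; apply: eq_bigr => i _; rewrite rowK.
  refine (eq_trans (linear_sum _ _ _ _) _).
  rewrite [RHS]rV_sum_delta; apply: eq_bigr => i _.
  exact: (eq_trans (linearZ _ _) (congr1 _ (bP _))).
have [V [s [oV V0 sV sS]]] := local_smooth_inverse oA' A'0 ga dg0.
exists V, (a \o s); split=> //.
- by rewrite -a0.
- by move=> k; apply: (@Ck_comp _ _ _ _ k V setT).
Qed.

End InverseFunction.

(** * Smooth maps between manifolds *)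

Arguments pdiff1 {R M N P} f c v.
Arguments pdiff2 {R M N P} f c v.

Section SmoothMaps.
Context {R : realType}.
Implicit Types M N P : @manifold R.

Lemma cinvP (T : topologicalType) n (a : chart (R := R) T n) x :
  cimg a x -> cdom a (cinv a x) /\ a (cinv a x) = x.
Proof. by move=> [p ap <-]; rewrite cmapK. Qed.

Lemma cimg_map (T : topologicalType) n (a : chart (R := R) T n) p :
  cdom a p -> cimg a (a p).
Proof. by move=> ap; exists p. Qed.

(** Domains of local representatives are open, as most of the [Ck] rules require. *)
Lemma smooth_dom_open M N (A : set M) (f : M -> N) (a : chart (R := R) M (mdim M))
    (b : chart (R := R) N (mdim N)) :
  open A -> (forall p, A p -> {for p, continuous f}) ->
  open [set x | [/\ cimg a x, A (cinv a x) & cdom b (f (cinv a x))]].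
Proof.
move=> oA fc; rewrite openE => x [ax Ax bx].
have ac := cinv_cont ax.
have n1 : nbhs x (cimg a) by apply: open_nbhs_nbhs; split=> //; exact: cimg_open.
have n2 : nbhs x (cinv a @^-1` A) by apply: ac; exact: open_nbhs_nbhs.
have n3 : nbhs x ((f \o cinv a) @^-1` cdom b).
  apply: (continuous_comp ac (fc _ Ax)); apply: open_nbhs_nbhs.
  by split=> //; exact: cdom_open.
by apply: filterS (filterI n1 (filterI n2 n3)) => y [? []].
Qed.

(** Near each point the representative factors through a chart of [N] at the image point; the
    factorization holds only on a smaller open set, hence [Ck_local]. *)
Lemma smooth_on_comp M N P (A : set M) (B : set N) (f : M -> N) (g : N -> P) :
  open A -> open B -> (forall p, A p -> B (f p)) ->
  smooth_on A f -> smooth_on B g -> smooth_on A (fun p => g (f p)).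
Proof.
move=> oA oB AB [fc fS] [gc gS].
have gfc p : A p -> {for p, continuous (fun p => g (f p))}.
  by move=> Ap; apply: continuous_comp (fc _ Ap) (gc _ (AB _ Ap)).
split=> // a c aa ac k.
apply: Ck_local => x [ax Ax cx].
pose b := chart_at (f (cinv a x)).
have ab : atlas b by exact: chart_at_atlas.
have o1 := @smooth_dom_open _ _ _ _ a b oA fc.
have o2 := @smooth_dom_open _ _ _ _ a c oA gfc.
exists ([set x | [/\ cimg a x, A (cinv a x) & cdom b (f (cinv a x))]] `&`
  [set x | [/\ cimg a x, A (cinv a x) & cdom c (g (f (cinv a x)))]]).
exists ((c \o g \o cinv b) \o (b \o f \o cinv a)); split.
- exact: openI.
- by split=> //; split=> //; exact: chart_at_dom.
- by move=> y [[_ _ by_] _] /=; rewrite cmapK.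
apply: Ck_comp (Ck_subset _ (fS a b aa ab k)) (gS b c ab ac k).
- exact: openI.
- move=> y [[ay Ay by_] [_ _ cy]] /=; rewrite cmapK //.
  by split=> //; [exact: cimg_map|exact: AB].
- by move=> y [].
Qed.

Lemma smooth_comp M N P (f : M -> N) (g : N -> P) :
  smooth f -> smooth g -> smooth (fun p => g (f p)).
Proof. by apply: smooth_on_comp => //; exact: openT. Qed.

Lemma smooth_local M N (f : M -> N) :
  (forall p, exists (W : set M) (g : M -> N),
    [/\ open W, W p, smooth_on W g & forall q, W q -> g q = f q]) -> smooth f.
Proof.
move=> h; split=> [p _|a b aa ab k].
  have [W [g [oW Wp [gc _] gf]]] := h p.
  rewrite /prop_for /continuous_at -(gf _ Wp).
  apply: cvg_trans (gc _ Wp); apply: near_eq_cvg.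
  by apply: filterS (open_nbhs_nbhs (conj oW Wp)) => q /gf.
apply: Ck_local => x [ax _ bx].
have [W [g [oW Wp [gc gS] gf]]] := h (cinv a x).
exists [set x | [/\ cimg a x, W (cinv a x) & cdom b (g (cinv a x))]].
exists (b \o g \o cinv a); split.
- exact: smooth_dom_open.
- by split=> //; rewrite gf.
- by move=> y [_ Wy _] /=; rewrite gf.
- exact: gS.
Qed.

Lemma smooth_id M : smooth (fun p : M => p).
Proof.
split=> [p _ //|a b aa ab k].
apply: Ck_subset (atlas_compat aa ab k).
by move=> x [].
Qed.

Lemma smooth_cst M N (q : N) : smooth (fun _ : M => q).
Proof.
split=> [p _|a b aa ab k]; first exact: cst_continuous.
exact: (Ck_cst k _ (b q)).
Qed.

Lemma row_mx_sum n p (V : normedModType R) (f : V -> 'rV[R]_n)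
  (g : V -> 'rV[R]_p) : (fun x => row_mx (f x) (g x)) =
    (@row_inl R n p \o f) + (@row_inr R n p \o g).
Proof.
apply/funext => x.
by rewrite fctE /= /row_inl /row_inr add_row_mx addr0 add0r.
Qed.

Lemma Ck_row_mx n p k (V : normedModType R) (A : set V) (f : V -> 'rV[R]_n)
    (g : V -> 'rV[R]_p) :
  open A -> Ck k A f -> Ck k A g -> Ck k A (fun x => row_mx (f x) (g x)).
Proof.
move=> oA hf hg; rewrite row_mx_sum; apply: CkD => //.
  by apply: Ck_linear_comp => //; exact: row_inl_continuous.
by apply: Ck_linear_comp => //; exact: row_inr_continuous.
Qed.

Lemma smooth_pair M N P (f : M -> N) (g : M -> P) :
  smooth f -> smooth g -> smooth ((fun p => (f p, g p)) : M -> prodM N P).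
Proof.
move=> [fc fS] [gc gS].
have c p : {for p, continuous ((fun p => (f p, g p)) : M -> prodM N P)}.
  exact: cvg_pair (fc p I) (gc p I).
split=> [p _ //|a _ aa [b [c' [ab ac ->]]] k].
apply: (@Ck_row_mx _ _ k _ _ (b \o f \o cinv a) (c' \o g \o cinv a)).
- exact: (@smooth_dom_open M (prodM N P) setT _ a (prod_chart b c') openT
    (fun p _ => c p)).
- by refine (Ck_subset _ (fS a b aa ab k)) => x [? _ []].
- by refine (Ck_subset _ (gS a c' aa ac k)) => x [? _ []].
Qed.

Lemma smooth_fst M N : smooth (fst : prodM M N -> M).
Proof.
have c (p : prodM M N) : {for p, continuous (fst : prodM M N -> M)}.
  exact: cvg_fst.
split=> [p _|_ c' [a [b [aa ab ->]]] ac k]; first exact: c.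
apply: (@Ck_comp _ _ _ _ _ _
  [set y | cimg a y /\ cdom c' (cinv a y)] (@lsubmx R 1 _ _) (c' \o cinv a)).
- exact: (@smooth_dom_open (prodM M N) M setT _ (prod_chart a b) c' openT
    (fun p _ => c p)).
- move=> x [abx _ cx].
  have [ax _] : (lsubmx @^-1` cimg a `&` rsubmx @^-1` cimg b) x.
    by rewrite -prod_cimgE.
  by split; [exact: ax|exact: cx].
- by apply: Ck_linear; exact: continuous_lsubmx.
- exact: (atlas_compat aa ac k).
Qed.

Lemma smooth_snd M N : smooth (snd : prodM M N -> N).
Proof.
have c (p : prodM M N) : {for p, continuous (snd : prodM M N -> N)}.
  exact: cvg_snd.
split=> [p _|_ c' [a [b [aa ab ->]]] ac k]; first exact: c.
apply: (@Ck_comp _ _ _ _ _ _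
  [set y | cimg b y /\ cdom c' (cinv b y)] (@rsubmx R 1 _ _) (c' \o cinv b)).
- exact: (@smooth_dom_open (prodM M N) N setT _ (prod_chart a b) c' openT
    (fun p _ => c p)).
- move=> x [abx _ cx].
  have [_ bx] : (lsubmx @^-1` cimg a `&` rsubmx @^-1` cimg b) x.
    by rewrite -prod_cimgE.
  by split; [exact: bx|exact: cx].
- by apply: Ck_linear; exact: continuous_rsubmx.
- exact: (atlas_compat ab ac k).
Qed.

Lemma smooth_continuous M N (f : M -> N) : smooth f -> continuous f.
Proof. by move=> [fc _] p; exact: fc. Qed.

Lemma smooth_rep M N (f : M -> N) (a : chart (R := R) M (mdim M))
    (b : chart (R := R) N (mdim N)) p :
  smooth f -> atlas a -> atlas b -> cdom a p -> cdom b (f p) ->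
  differentiable (b \o f \o cinv a) (a p) /\
  \forall x \near a p, [/\ cimg a x, True & cdom b (f (cinv a x))].
Proof.
move=> [fc fS] aa ab ap bp.
have Dp : [/\ cimg a (a p), True & cdom b (f (cinv a (a p)))].
  by split=> //; [exact: cimg_map|rewrite cmapK].
split; first by have [+ _] := fS a b aa ab 1; exact.
apply: open_nbhs_nbhs; split=> //.
exact: (@smooth_dom_open _ _ setT f a b openT).
Qed.

(** Both factors use the chart [chart_at (f p)] in the middle. The composed representatives agree
    with that of the composite near [chart_at p p], which determines the differential there. *)
Lemma mdiff_comp M N P (f : M -> N) (g : N -> P) p v :
  smooth f -> smooth g ->
  mdiff (fun q => g (f q)) p v = mdiff g (f p) (mdiff f p v).
Proof.
move=> sf sg; rewrite /mdiff.
set a := chart_at p; set b := chart_at (f p); set c := chart_at (g (f p)).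
have ap : cdom a p by exact: chart_at_dom.
have bp : cdom b (f p) by exact: chart_at_dom.
have [dF nF] := smooth_rep sf (chart_at_atlas p) (chart_at_atlas (f p)) ap bp.
have [dG _] := smooth_rep sg (chart_at_atlas (f p)) (chart_at_atlas (g (f p)))
  bp (chart_at_dom _).
have Fp : (b \o f \o cinv a) (a p) = b (f p) by rewrite /= cmapK.
have dG' : differentiable (c \o g \o cinv b) ((b \o f \o cinv a) (a p)).
  by rewrite Fp.
have E : \forall x \near a p, ((c \o g \o cinv b) \o (b \o f \o cinv a)) x =
    (c \o (fun q => g (f q)) \o cinv a) x.
  by apply: filterS nF => x [_ _ bx] /=; rewrite cmapK.
have [_ dE] := near_eq_diff E (differentiable_comp dF dG').
refine (eq_trans (congr1 (@^~ v) dE) _).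
refine (eq_trans (congr1 (@^~ v) (diff_comp dF dG')) _).
exact: (congr1 (fun y => 'd (c \o g \o cinv b) y
  ('d (b \o f \o cinv a) (a p) v)) Fp).
Qed.

Lemma mdiff_id M (p : M) v : mdiff (fun q => q) p v = v.
Proof.
rewrite /mdiff; set a := chart_at p.
have E : \forall x \near a p, x = (a \o (fun q => q) \o cinv a) x.
  have : nbhs (a p) (cimg a).
    by apply: open_nbhs_nbhs; split; [exact: cimg_open|exact/cimg_map/chart_at_dom].
  by apply: filterS => x /cinvP[_ /= ->].
have [di dE] := is_diff_id (a p).
have [_ h] := near_eq_diff E di.
refine (eq_trans (congr1 (@^~ v) h) _).
exact: (congr1 (@^~ v) dE).
Qed.

Lemma mdiff_cst M N (q : N) (p : M) v : mdiff (fun _ => q) p v = 0.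
Proof. exact: (congr1 (@^~ v) (diff_cst (chart_at q q) (chart_at p p))). Qed.

Lemma mdiffD M N (f : M -> N) p v w : mdiff f p (v + w) = mdiff f p v + mdiff f p w.
Proof. exact: linearD. Qed.

Lemma row_mx_diff n p (V : normedModType R) (f : V -> 'rV[R]_n)
    (g : V -> 'rV[R]_p) x v :
  differentiable f x -> differentiable g x ->
  'd (fun y => row_mx (f y) (g y)) x v = row_mx ('d f x v) ('d g x v).
Proof.
move=> df dg; rewrite row_mx_sum.
have dl := row_inl_differentiable p (f x).
have dr := row_inr_differentiable n (g x).
refine (eq_trans (congr1 (@^~ v) (diffD (differentiable_comp df dl)
  (differentiable_comp dg dr))) _).
refine (eq_trans (f_equal2 +%R (congr1 (@^~ v) (diff_comp df dl))
  (congr1 (@^~ v) (diff_comp dg dr))) _).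
refine (eq_trans (f_equal2 +%R (congr1 (@^~ _) (diff_row_inl p (f x)))
  (congr1 (@^~ _) (diff_row_inr n (g x)))) _).
by rewrite /row_inl /row_inr add_row_mx addr0 add0r.
Qed.

(** The chart that [prodM] singles out at a pair is the product of the singled-out charts, so the
    representative is a [row_mx] by conversion. *)
Lemma mdiff_pair M N P (f : M -> N) (g : M -> P) p v :
  smooth f -> smooth g ->
  mdiff ((fun q => (f q, g q)) : M -> prodM N P) p v =
  row_mx (mdiff f p v) (mdiff g p v).
Proof.
move=> sf sg; apply: row_mx_diff.
  by have [] := smooth_rep sf (chart_at_atlas p) (chart_at_atlas (f p))
    (chart_at_dom _) (chart_at_dom _).
by have [] := smooth_rep sg (chart_at_atlas p) (chart_at_atlas (g p))
    (chart_at_dom _) (chart_at_dom _).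
Qed.

(** Chain rule for the inclusion of a slice, whose differential sends [v] to [row_mx v 0]. *)
Lemma pdiff1E M N P (f : prodM M N -> P) (p : prodM M N) v :
  smooth f -> pdiff1 f p v = mdiff f p (row_mx v 0).
Proof.
case: p v => p q v sf; rewrite /pdiff1 /=.
rewrite (mdiff_comp (f := (fun x => (x, q)) : M -> prodM M N) (g := f)) //.
  rewrite mdiff_pair ?mdiff_id ?mdiff_cst //.
  - exact: smooth_id.
  - exact: smooth_cst.
by apply: smooth_pair; [exact: smooth_id|exact: smooth_cst].
Qed.

Lemma pdiff2E M N P (f : prodM M N -> P) (p : prodM M N) v :
  smooth f -> pdiff2 f p v = mdiff f p (row_mx 0 v).
Proof.
case: p v => p q v sf; rewrite /pdiff2 /=.
rewrite (mdiff_comp (f := (fun x => (p, x)) : N -> prodM M N) (g := f)) //.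
  rewrite mdiff_pair ?mdiff_id ?mdiff_cst //.
  - exact: smooth_cst.
  - exact: smooth_id.
by apply: smooth_pair; [exact: smooth_cst|exact: smooth_id].
Qed.

Lemma mdiff_prod M N P (f : prodM M N -> P) (p : prodM M N) v w :
  smooth f -> mdiff f p (row_mx v w) = pdiff1 f p v + pdiff2 f p w.
Proof.
move=> sf; rewrite pdiff1E // pdiff2E // -mdiffD.
by rewrite add_row_mx addr0 add0r.
Qed.

End SmoothMaps.

(** * Local sections of submersions and descent of smoothness *)

Section Descent.
Context {R : realType}.
Implicit Types M N P : @manifold R.

Lemma submersion_local_section M N (f : M -> N) p :
  submersion f -> exists (W : set N) (s : N -> M),
    [/\ open W, W (f p), smooth_on W s & forall q, W q -> f (s q) = q].
Proof.
move=> [sf df]; pose a := chart_at p; pose b := chart_at (f p).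
have aa : atlas a by exact: chart_at_atlas.
have ab : atlas b by exact: chart_at_atlas.
have ap : cdom a p by exact: chart_at_dom.
have bp : cdom b (f p) by exact: chart_at_dom.
pose D := [set x | [/\ cimg a x, setT (cinv a x) & cdom b (f (cinv a x))]].
have oD : open D.
  by apply: smooth_dom_open; [exact: openT|move=> q _; exact: smooth_continuous].
have Dp : D (a p) by split=> //; [exact: cimg_map|rewrite cmapK].
(* Tangent vectors are coordinates in the [chart_at] charts, so [df p] is already surjectivity of
   the differential of the representative. *)
have [V [s [oV Vp sV sS]]] :=
  local_smooth_section oD Dp (sf.2 a b aa ab) (df p).
have Vbp : V (b (f p)) by move: Vp; rewrite /= cmapK.
pose W := cdom b `&` b @^-1` V.
have Wp : W (f p) by [].
have oW : open W.
  rewrite openE => q [bq Vq]; apply: filterI.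
    by apply: open_nbhs_nbhs; split=> //; exact: cdom_open.
  by apply: (cmap_cont bq); exact: open_nbhs_nbhs.
pose sg := cinv a \o (s \o b).
have sgc q : W q -> {for q, continuous sg}.
  move=> [bq Vq]; have [[av _ _] _] := sV _ Vq.
  have c1 : {for b q, continuous s} by exact: (sS 0%N).
  have c2 : {for q, continuous (s \o b)}.
    exact: continuous_comp (cmap_cont bq) c1.
  by apply: continuous_comp c2 _; exact: cinv_cont.
exists W, sg; split=> //; last first.
  move=> q [bq Vq]; have [[av _ bv] fv] := sV _ Vq.
  by rewrite -[RHS](cmapK bq) -fv /= cmapK.
split=> // b' a' ab' aa' k.
pose X := [set x | [/\ cimg b' x, W (cinv b' x) & cdom a' (sg (cinv b' x))]].
have oX : open X by exact: smooth_dom_open.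
have h1 : Ck k X (b \o cinv b').
  refine (Ck_subset _ (atlas_compat ab' ab k)) => x [b'x [bx _] _].
  by split.
have h2 : Ck k X (s \o (b \o cinv b')).
  by apply: Ck_comp h1 (sS k) => // x [_ [_ Vx] _].
have h3 := atlas_compat aa aa' k.
refine (Ck_comp oX _ h2 h3) => x [_ [_ Vx] a'x].
by have [[av _ _] _] := sV _ Vx; split.
Qed.

(** Locally [F] is [h] composed with a smooth section of [f]. *)
Lemma smooth_descend M N P (f : M -> N) (h : M -> P) (F : N -> P) :
  submersion f -> (forall q, exists p, f p = q) -> smooth h ->
  (forall p, F (f p) = h p) -> smooth F.
Proof.
move=> sf surj sh Ff; apply: smooth_local => q.
have [p <-] := surj q.
have [W [s [oW Wp sW fs]]] := submersion_local_section p sf.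
exists W, (fun y => h (s y)); split=> //.
  exact: smooth_on_comp oW openT _ sW sh.
by move=> y Wy; rewrite -Ff fs.
Qed.

End Descent.

(** * Discrete connections and reduction *)

Section LieGroupTheory.
Context {R : realType} (G : @lie_group R).
Local Notation "x ** y" := (lgmul x y) (at level 40, left associativity).
Local Notation one := (lgone G).
Local Notation inv := (@lginv R G).
Implicit Types x y z : G.

Lemma lgmulKl x y : inv x ** (x ** y) = y.
Proof. by rewrite lgmulA lgmulV lgmul1. Qed.

(** [lie_group] has only left axioms; the right unit law follows on multiplying [x ** one] on the
    left by [inv x] and then by [inv (inv x)]. *)
Lemma lgmulr1 x : x ** one = x.
Proof.
by rewrite -[LHS](lgmulKl (inv x)) (lgmulKl x) -(lgmulV x) lgmulKl.
Qed.

Lemma lginvK x : inv (inv x) = x.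
Proof. by rewrite -[RHS](lgmulKl (inv x)) lgmulV lgmulr1. Qed.

Lemma lgmulVr x : x ** inv x = one.
Proof. by rewrite -{1}[x]lginvK lgmulV. Qed.

Lemma lgmulKVl x y : x ** (inv x ** y) = y.
Proof. by rewrite lgmulA lgmulVr lgmul1. Qed.

Lemma lgmulKr x y : y ** x ** inv x = y.
Proof. by rewrite -lgmulA lgmulVr lgmulr1. Qed.

Lemma lgmulKVr x y : y ** inv x ** x = y.
Proof. by rewrite -lgmulA lgmulV lgmulr1. Qed.

Lemma lginvM x y : inv (x ** y) = inv y ** inv x.
Proof. by rewrite -[RHS](lgmulKl (x ** y)) -lgmulA lgmulKVl lgmulVr lgmulr1. Qed.

Variables (X : @manifold R) (l : free_left_action G X).

Lemma lactK g p : l (inv g) (l g p) = p.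
Proof. by rewrite -lactM lgmulV lact1. Qed.

Lemma lactKV g p : l g (l (inv g) p) = p.
Proof. by rewrite -lactM lgmulVr lact1. Qed.

Variables (Q : @manifold R) (pi : X -> Q) (A : discrete_connection l pi).

(** [(g ** A m0 m1)^-1] sends [l g m1] to the same point as [(A m0 m1)^-1] sends [m1], and [dc_funP]
    characterizes the value. *)
Lemma dc_actr g m0 m1 : A m0 (l g m1) = g ** A m0 m1.
Proof.
by apply/esym/dc_funP; rewrite lginvM lactM lactK; apply/dc_funP.
Qed.

(** Invariance of [dc_hor] under the diagonal action, read through [dc_funP]. *)
Lemma dc_equivariant g m0 m1 :
  A (l g m0) (l g m1) = g ** A m0 m1 ** inv g.
Proof.
apply/esym/dc_funP; rewrite !lginvM lginvK !lactM lactK.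
by apply: dc_hor_invariant; apply/dc_funP.
Qed.

Lemma dc_actl g m0 m1 : A (l g m0) m1 = A m0 m1 ** inv g.
Proof.
by rewrite -{1}(lactKV g m1) dc_equivariant dc_actr lgmulKVl.
Qed.

End LieGroupTheory.

(** * The reduction map: its fibres, its differential and the change of connection *)

Section ReductionMap.
Context {R : realType} (G : @lie_group R) (E M F : @manifold R)
  (phi : fiber_bundle E M F) (a : bundle_action G phi)
  (GE : conjugate_bundle a).
Local Notation connection := (discrete_connection (actM a) (@piM R G E M F phi a)).
Implicit Types A : connection.

Lemma cb_quot_submersion : submersion (cb_quot GE).
Proof. by have [] := cb_quotP GE. Qed.

Lemma piM_submersion : submersion (piM a).
Proof. by have [] := piM_principal a. Qed.

Lemma piM_act g m : piM a (actM a g m) = piM a m.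
Proof. by have [_ _ h] := piM_principal a; apply/esym/h; exists g. Qed.

Lemma red_map_act A g c : red_map GE A (actC a g c) = red_map GE A c.
Proof.
have [_ _ h] := cb_quotP GE; congr (_, _); last exact: piM_act.
by apply/esym/h; exists g; rewrite /actEG /= act_equivariant dc_equivariant.
Qed.

(** Equal first components give [g] with [e' = g e]; equal second ones give [k] with [m' = k (g m)].
    Comparing the values of [A] yields [k w = w], so [k] is the unit. *)
Lemma red_map_eq A c d :
  red_map GE A c = red_map GE A d -> exists g, d = actC a g c.
Proof.
case: c d => [e m] [e' m'] [/=].
have [_ _ hq] := cb_quotP GE => /hq[g [-> Ag]] pm.
have [_ _ hp] := piM_principal a.
have /hp[k mk] : piM a (actM a g m) = piM a m' by rewrite piM_act.
exists g; rewrite /actC /= mk; congr (_, _).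
move: Ag; rewrite mk dc_actr act_equivariant dc_equivariant => Ag.
have -> : k = lgone G; last exact: lact1.
set w := lgmul _ (lginv g) in Ag.
by rewrite -[LHS](lgmulKr w) Ag lgmulVr.
Qed.

Lemma red_map_surj A d : exists c, red_map GE A c = d.
Proof.
case: d => u q.
have [_ sq _] := cb_quotP GE; have [_ sp _] := piM_principal a.
have [[e w] <-] := sq u; have [m <-] := sp q.
(* Moving [m] along its orbit multiplies [A (phi e) m] on the left; this factor turns it into
   [w]. *)
exists (e, actM a (lgmul w (lginv (A (phi e) m))) m).
by congr (cb_quot _ (_, _), _); rewrite /= ?piM_act ?dc_actr ?lgmulKVr.
Qed.

Lemma red_map_smooth A : smooth (red_map GE A).
Proof.
have sphi : smooth (fun c : prodM E M => phi c.1).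
  by apply: smooth_comp (bproj_smooth phi); exact: smooth_fst.
have sA : smooth (fun c : prodM E M => A (phi c.1) c.2).
  have h := smooth_pair sphi (@smooth_snd R E M).
  exact: (smooth_comp h (dc_fun_smooth A)).
have sEA := smooth_pair (@smooth_fst R E M) sA.
have s1 := smooth_comp sEA cb_quot_submersion.1.
have s2 := smooth_comp (@smooth_snd R E M) piM_submersion.1.
exact: (smooth_pair s1 s2).
Qed.

Lemma red_map1_smooth A : smooth (fun c => (red_map GE A c).1).
Proof. exact: (smooth_comp (red_map_smooth A) (@smooth_fst _ _ _)). Qed.

Lemma mdiff_onto_factor (X Y Z : @manifold R) (rho : X -> Y) (kappa : Y -> Z)
    (q : X -> Z) x y :
  smooth rho -> smooth kappa -> (forall z, kappa (rho z) = q z) -> rho x = y ->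
  (forall w, exists v, mdiff q x v = w) -> forall w, exists v, mdiff kappa y v = w.
Proof.
move=> srho skappa /funext krho <- qonto w.
have [v vw] : exists v, mdiff (fun z => kappa (rho z)) x v = w.
  by rewrite krho; exact: qonto.
by exists (mdiff rho x v); rewrite -mdiff_comp.
Qed.

Lemma red_map_D1_onto A c (w : tangent (red_map GE A c).1) :
  exists v, pdiff1 (fun c => (red_map GE A c).1) c v = w.
Proof.
case: c w => e m w.
pose g (x : prodM E G) := lgmul (A (phi x.1) m) (lginv x.2).
pose rho (x : prodM E G) : E := actE a (g x) x.1.
have sphi : smooth (fun x : prodM E G => phi x.1).
  by apply: smooth_comp (bproj_smooth phi); exact: smooth_fst.
have sA : smooth (fun x : prodM E G => A (phi x.1) m).
  have h := smooth_pair sphi (@smooth_cst R (prodM E G) M m).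
  exact: (smooth_comp h (dc_fun_smooth A)).
have sV : smooth (fun x : prodM E G => lginv x.2).
  exact: (smooth_comp (@smooth_snd R E G) (@lginv_smooth R G)).
have sg : smooth g.
  exact: (smooth_comp (smooth_pair sA sV) (@lgmul_smooth R G)).
have srho : smooth rho.
  exact: (smooth_comp (smooth_pair sg (@smooth_fst R E G)) (lact_smooth (actE a))).
have skappa : smooth (fun e => (red_map GE A (e, m)).1).
  have h := smooth_pair (@smooth_id R E) (@smooth_cst R E M m).
  exact: (smooth_comp h (red_map1_smooth A)).
apply: (mdiff_onto_factor (rho := rho) (q := cb_quot GE) (x := (e, A (phi e) m))).
- exact: srho.
- exact: skappa.
- move=> [e' k]; have [_ _ hq] := cb_quotP GE.
  (* Conjugating [k] by [g (e', k) = A (phi e', m) k^-1] and evaluating [A] at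
     [(phi (rho (e', k)), m)] both give [A (phi e', m)] times the inverse of [g (e', k)]. *)
  apply/esym/hq; exists (g (e', k)).
  rewrite /actEG /rho /g /=; congr (_, _).
  rewrite act_equivariant dc_actl lginvM lginvK.
  by rewrite lgmulKVr lgmulA.
- by rewrite /rho /g /= lgmulVr lact1.
- exact: cb_quot_submersion.2.
Qed.

(** The first block is the right-hand side of [red_chain], which lets the chaining map be expressed
    by the full differential of [red_map]. *)
Lemma red_map_mdiff A (c : prodM E M) v w :
  mdiff (red_map GE A) c (row_mx v w) =
  row_mx (pdiff1 (fun c => (red_map GE A c).1) c v +
          pdiff2 (fun c => (red_map GE A c).1) c w) (mdiff (piM a) c.2 w).
Proof.
have s2 : smooth (fun c : prodM E M => piM a c.2).
  exact: (smooth_comp (@smooth_snd R E M) piM_submersion.1).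
refine (eq_trans (mdiff_pair (p := c) (row_mx v w) (red_map1_smooth A) s2) _).
rewrite (mdiff_prod c v w (red_map1_smooth A)).
rewrite (mdiff_prod c v w s2).
have -> : pdiff1 (fun c : prodM E M => piM a c.2) c v = 0.
  exact: (mdiff_cst (piM a c.2) v).
by rewrite add0r.
Qed.

Lemma red_map_mdiff_bundle A (c : prodM E M) v :
  mdiff GE (red_map GE A c).1 (pdiff1 (fun c => (red_map GE A c).1) c v) =
  mdiff (piM a) (phi c.1) (mdiff phi c.1 v).
Proof.
case: c v => e m v.
have sk : smooth (fun e => (red_map GE A (e, m)).1).
  have h := smooth_pair (@smooth_id R E) (@smooth_cst R E M m).
  exact: (smooth_comp h (red_map1_smooth A)).
refine (eq_trans (esym (mdiff_comp (p := e) v sk (bproj_smooth GE))) _).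
refine (eq_trans _ (mdiff_comp (p := e) v (bproj_smooth phi) piM_submersion.1)).
have E2 : (fun e => GE (red_map GE A (e, m)).1) = (fun e => piM a (phi e)).
  by apply/funext => e'; rewrite cb_proj.
exact: (congr1 (fun f => mdiff f e v : 'rV[R]_(mdim (orbM a))) E2).
Qed.

(** The second component is solved through [piM]; the first is then corrected by
    [red_map_D1_onto]. *)
Lemma red_map_submersion A : submersion (red_map GE A).
Proof.
split=> [|c w]; first exact: red_map_smooth.
have [v2 v2E] := piM_submersion.2 c.2 (rsubmx w).
have [v1 v1E] := red_map_D1_onto (A := A) (c := c)
  (lsubmx w - pdiff2 (fun c => (red_map GE A c).1) c v2).
exists (row_mx v1 v2).
rewrite red_map_mdiff v1E v2E.
exact: (eq_trans (congr1 (row_mx^~ _) (subrK _ _)) (hsubmxK w)).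
Qed.

(** For independent lifts, the condition downstairs only says that [x0.2] and [phi x1.1] lie in one
    orbit; translating [x0] makes them equal without changing its image. *)
Lemma red_map_C2_lift A c0 c1 : inC2 GE c0 c1 -> exists x0 x1,
  [/\ inC2 phi x0 x1, red_map GE A x0 = c0 & red_map GE A x1 = c1].
Proof.
have [x0 <-] := red_map_surj A c0; have [x1 <-] := red_map_surj A c1.
rewrite /inC2 /= cb_proj => h.
have [_ _ hp] := piM_principal a.
have [g gE] := (hp _ _).1 h.
exists (actC a g x0), x1; split=> //; exact: red_map_act.
Qed.

(** * The map relating the reductions for two connections *)

Section ChangeConnection.
Variables (A1 A2 : connection).

(** The preimage picked by [cid] is immaterial, by [red_transferE]: two preimages differ by the
    action, under which [red_map GE A2] is invariant. *)
Definition red_transfer (d : prodM (cb_total GE) (orbM a)) :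
    prodM (cb_total GE) (orbM a) :=
  red_map GE A2 (projT1 (cid (red_map_surj A1 d))).

Lemma red_transferE c : red_transfer (red_map GE A1 c) = red_map GE A2 c.
Proof.
rewrite /red_transfer; case: cid => d /= dc.
by have [g ->] := red_map_eq dc; rewrite red_map_act.
Qed.

Lemma red_transfer_snd d : (red_transfer d).2 = d.2.
Proof. by have [c <-] := red_map_surj A1 d; rewrite red_transferE. Qed.

Lemma red_transfer_smooth : smooth red_transfer.
Proof.
exact: (smooth_descend (red_map_submersion A1) (red_map_surj A1)
  (red_map_smooth A2) red_transferE).
Qed.

Lemma red_transfer1_smooth : smooth (fun d => (red_transfer d).1).
Proof. exact: (smooth_comp red_transfer_smooth (@smooth_fst _ _ _)). Qed.

(** For fixed [m] the second component of [red_map GE A1 (e, m)] is constantly [piM a m], so the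
    partial differentials compose by the ordinary chain rule. *)
Lemma red_transfer_pdiff1 c (v : tangent c.1) :
  pdiff1 (fun d => (red_transfer d).1) (red_map GE A1 c)
    (pdiff1 (fun c => (red_map GE A1 c).1) c v) =
  pdiff1 (fun c => (red_map GE A2 c).1) c v.
Proof.
case: c v => e m v; rewrite /pdiff1 /=.
have sk : smooth (fun e => (red_map GE A1 (e, m)).1).
  have h := smooth_pair (@smooth_id R E) (@smooth_cst R E M m).
  exact: (smooth_comp h (red_map1_smooth A1)).
have sY : smooth (fun u => (red_transfer (u, piM a m)).1).
  have h := smooth_pair (@smooth_id R (cb_total GE))
    (@smooth_cst R (cb_total GE) (orbM a) (piM a m)).
  exact: (smooth_comp h red_transfer1_smooth).
refine (eq_trans (esym (mdiff_comp (p := e) v sk sY)) _).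
have -> // : (fun e => (red_transfer ((red_map GE A1 (e, m)).1, piM a m)).1) =
  (fun e => (red_map GE A2 (e, m)).1).
by apply/funext => e'; rewrite -red_transferE.
Qed.

Lemma red_transfer_submersion : submersion red_transfer.
Proof.
split=> [|d]; first exact: red_transfer_smooth.
have [c cd] := red_map_surj A1 d.
exact: (mdiff_onto_factor (red_map_smooth A1) red_transfer_smooth
  red_transferE cd ((red_map_submersion A2).2 c)).
Qed.

Lemma red_transfer_C2 d0 d1 :
  inC2 GE d0 d1 -> inC2 GE (red_transfer d0) (red_transfer d1).
Proof.
have [x1 <-] := red_map_surj A1 d1.
by rewrite /inC2 red_transfer_snd red_transferE /= !cb_proj.
Qed.

End ChangeConnection.

Lemma red_transferK A1 A2 : cancel (red_transfer A1 A2) (red_transfer A2 A1).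
Proof. by move=> d; have [c <-] := red_map_surj A1 d; rewrite !red_transferE. Qed.

(** All tangent spaces of a manifold are the same type of row vectors by conversion, so changing
    base points needs no transport. *)
Lemma chain_congr (D : dlps GE) c0 c0' c1 c1' (h : inC2 GE c0 c1)
    (h' : inC2 GE c0' c1') (v : 'rV[R]_(mdim (cb_total GE))) :
  c0 = c0' -> c1 = c1' ->
  chain D h v = chain D h' v :> 'rV[R]_(mdim (cb_total GE)).
Proof. by move=> e0 e1; subst c0' c1'; rewrite (Prop_irrelevance h h'). Qed.

Lemma red_transfer_morphism (D : dlps phi) A1 A2 (D1 D2 : dlps GE) :
  reduced_dlps A1 D D1 -> reduced_dlps A2 D D2 ->
  lp_morphism D1 D2 (red_transfer A1 A2).
Proof.
move=> [L1 P1] [L2 P2].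
(* The proof of the [C''] condition is given first because the chaining condition depends on it. *)
refine (@LPMorphism _ _ _ _ _ _ _ _ _ _ _ _ _ _ _ _ (@red_transfer_C2 A1 A2) _ _).
- exact: red_transfer_submersion.
- by move=> d; exists (red_transfer A2 A1 d); rewrite red_transferK.
- move=> d; have [c <-] := red_map_surj A1 d; rewrite red_transferE => w.
  have [v vw] := red_map_D1_onto (A := A2) (c := c) w.
  exists (pdiff1 (fun c => (red_map GE A1 c).1) c v).
  by rewrite red_transfer_pdiff1.
- move=> d v.
  have E2 : (fun u => (red_transfer A1 A2 (u, d.2)).2) = (fun _ => d.2).
    by apply/funext => u; rewrite red_transfer_snd.
  exact: (eq_trans (congr1 (fun f => mdiff f d.1 v : 'rV[R]_(mdim (orbM a))) E2)
    (mdiff_cst d.2 v)).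
- by move=> d; have [c <-] := red_map_surj A1 d; rewrite red_transferE L1 L2.
move=> d0 d1 h v.
have [x0 [x1 [hx x0d x1d]]] := red_map_C2_lift A1 h.
subst d0 d1.
have [w wv] := red_map_D1_onto (A := A1) (c := x1) v.
rewrite -wv red_transfer_pdiff1.
have h2 : inC2 GE (red_map GE A2 x0) (red_map GE A2 x1).
  by have := red_transfer_C2 A1 A2 h; rewrite !red_transferE.
refine (eq_trans (chain_congr D2 _ h2 _ (red_transferE A1 A2 x0)
  (red_transferE A1 A2 x1)) _).
refine (eq_trans (P2 _ _ hx h2 w) _).
rewrite (P1 _ _ hx h w) red_map_mdiff_bundle.
(* As [x0.2 = phi x1.1], the base component is that of [red_map_mdiff] at [x0], and the row vector
   becomes a differential of [red_map GE A1]. *)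
have -> : mdiff (piM a) (phi x1.1) (mdiff phi x1.1 w) =
    mdiff (piM a) x0.2 (mdiff phi x1.1 w) by rewrite hx.
rewrite -red_map_mdiff.
(* Both sides are now differentials at [x0] of the same function, on the right through the chain
   rule. *)
refine (eq_trans (esym (mdiff_prod x0 _ _ (red_map1_smooth A2))) _).
refine (eq_trans _ (mdiff_comp (p := x0) _ (red_map_smooth A1)
  (red_transfer1_smooth A1 A2))).
have E2 : (fun c => (red_map GE A2 c).1) =
    (fun c => (red_transfer A1 A2 (red_map GE A1 c)).1).
  by apply/funext => c; rewrite red_transferE.
exact: (congr1 (fun f => mdiff f x0 _ : 'rV[R]_(mdim (cb_total GE))) E2).
Qed.

End ReductionMap.

Theorem proposition5p14 (R : realType) (G : @lie_group R)
  (E M F : @manifold R) (phi : fiber_bundle E M F) (D : dlps phi)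
  (a : bundle_action G phi) (sym : symmetry_group a D)
  (A1 A2 : discrete_connection (actM a) (@piM R G E M F phi a))
  (GE : conjugate_bundle a) (D1 D2 : dlps GE)
  (red1 : reduced_dlps A1 D D1) (red2 : reduced_dlps A2 D D2) :
  lp_isomorphic D1 D2.
Proof.
exists (red_transfer A1 A2), (red_transfer A2 A1); split.
- exact: red_transfer_morphism red1 red2.
- exact: red_transfer_morphism red2 red1.
- exact: red_transferK.
- exact: red_transferK.
Qed.
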